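(* Let $M$ be a smooth manifold diffeomorphic to $\mathbb{T}^d$ and let $\varphi_t:M\to M$ be a smooth flow which is $C^\infty$-conjugate to a rigid rotation: there is a $C^\infty$ diffeomorphism $\Phi:M\to\mathbb{T}^d$ with $\Phi(\varphi_t(x))=\Phi(x)+t\omega \pmod 1$ for all $t,x$, where $\omega\in\mathcal{D}_{c,\tau}$ for some $c>0$, $\tau\ge d-1$. Let $\mu$ be the $\varphi_t$-invariant probability measure on $M$ that is the pullback under $\Phi$ of Lebesgue (Haar) measure $d\theta$ on $\mathbb{T}^d$. (i) If $h\in C^\infty(M,\mathbb{R})$ and $g\in\mathcal{G}_\infty$, then for every $m\in\mathbb{N}$ there is a constant $c_m>0$, independent of $x$, such that \[ \left|W\!B_T(h)(x)-\int_M h\,d\mu\right|\le c_m T^{-m}\quad\text{for all } T>0 \text{ and all } x\in M . \] (ii) More generally, if $m\in\mathbb{N}$, $g\in\mathcal{G}_m$ and $h\in C^l(M,\mathbb{R})$ with $l>d+m\tau$, then there is a constant $c>0$ independent of $x$ and $T$ such that $\left|W\!B_T(h)(x)-\int_M h\,d\mu\right|\le c\,T^{-m}$ for all $T>0$ and $x\in M$.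
   Context: A vector $\omega\in\mathbb{R}^d$ is Diophantine, $\omega\in\mathcal{D}_{c,\tau}$ (with $c>0$, $\tau\ge d-1$), if $|k\cdot\omega|>c\|k\|^{-\tau}$ for all $k\in\mathbb{Z}^d\setminus\{0\}$. For $m\in\mathbb{N}\cup\{\infty\}$, $\mathcal{G}_m$ is the set of $g\in C^m([0,1],[0,\infty))$ with $\int_0^1g(s)\,ds=1$ and $g^{(i)}(0)=g^{(i)}(1)=0$ for $i=0,\dots,m-1$ (all $i\ge0$ when $m=\infty$). The weighted Birkhoff average is $W\!B_T(h)(x)=\frac1T\int_0^T g(t/T)\,h(\varphi_t(x))\,dt$. *)

(* Defs.v *)
From HB Require Import structures.
From mathcomp Require Import all_boot all_order all_algebra.
From mathcomp Require Import all_classical all_reals all_analysis.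
Set Implicit Arguments. Unset Strict Implicit. Unset Printing Implicit Defensive.
Import Order.TTheory GRing.Theory Num.Theory numFieldNormedType.Exports.
Local Open Scope classical_set_scope.
Local Open Scope ring_scope.

Section Defs.
Variable R : realType.

Definition zdot (d : nat) (k : 'rV[int]_d) (w : 'rV[R]_d) : R :=
  \sum_(i < d) (k 0 i)%:~R * w 0 i.

Definition znorm (d : nat) (k : 'rV[int]_d) : R :=
  \big[Num.max/0]_(i < d) `|(k 0 i)%:~R : R|.

Definition diophantine (d : nat) (c tau : R) (w : 'rV[R]_d) : Prop :=
  forall k : 'rV[int]_d, k != 0 -> c * (znorm k) `^ (- tau) < `|zdot k w|.

Definition fracv (d : nat) (v : 'rV[R]_d) : 'rV[R]_d :=
  \row_i (v 0 i - (Num.floor (v 0 i))%:~R).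

Definition in_fund (d : nat) (v : 'rV[R]_d) : Prop :=
  forall i, 0 <= v 0 i < 1.

(* Z^d-periodic function on R^d = function on T^d *)
Definition periodic (d : nat) (H : 'rV[R]_d -> R) : Prop :=
  forall (v : 'rV[R]_d) (k : 'rV[int]_d), H (v + map_mx (fun z => z%:~R) k) = H v.

Definition evec (d : nat) (i : 'I_d) : 'rV[R]_d := \row_j (i == j)%:R.

Fixpoint Ck (d : nat) (l : nat) (H : 'rV[R]_d -> R) : Prop :=
  match l with
  | 0 => continuous H
  | l'.+1 => continuous H /\
      forall i : 'I_d, (forall x, derivable H x (evec i)) /\
                       Ck l' (fun x => 'D_(evec i) H x)
  end.

Definition Cinf (d : nat) (H : 'rV[R]_d -> R) : Prop := forall l, Ck l H.

(* Integral over T^d = [0,1)^d w.r.t. Haar (Lebesgue) measure, written as the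
   iterated integral over the unit cube (equal to the product-Lebesgue integral
   for the continuous integrands considered here). *)
Fixpoint torus_int (d : nat) : ('rV[R]_d -> R) -> R :=
  match d with
  | 0 => fun H => H 0
  | d'.+1 => fun H =>
      Rintegral (@lebesgue_measure R) `[0, 1]%classic
        (fun x : R => torus_int (fun y : 'rV[R]_d' =>
            H (row_mx (const_mx x : 'rV[R]_1) y)))
  end.

(* g \in C^m([0,1]): derivatives g^(0..m) exist on [0,1] (one-sided at the
   endpoints, i.e. within [0,1]) and are continuous on [0,1];
   gs i is the i-th derivative. *)
Definition derivs_on01 (m : nat) (g : R -> R) (gs : nat -> R -> R) : Prop :=
  (forall x, 0 <= x <= 1 -> gs 0%N x = g x) /\
  (forall i, (i < m)%N -> forall x, 0 <= x <= 1 ->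
     (fun y => (gs i y - gs i x) / (y - x)) @
        within (fun y => 0 <= y <= 1 /\ y != x) (nbhs x) --> gs i.+1 x) /\
  (forall i, (i <= m)%N -> {within `[0, 1], continuous (gs i)}).

Definition Gm (m : nat) (g : R -> R) : Prop :=
  exists gs : nat -> R -> R, derivs_on01 m g gs /\
    (forall x, 0 <= x <= 1 -> 0 <= g x) /\
    Rintegral (@lebesgue_measure R) `[0, 1]%classic g = 1 /\
    (forall i, (i < m)%N -> gs i 0 = 0 /\ gs i 1 = 0).

Definition Ginf (g : R -> R) : Prop :=
  exists gs : nat -> R -> R, (forall m, derivs_on01 m g gs) /\
    (forall x, 0 <= x <= 1 -> 0 <= g x) /\
    Rintegral (@lebesgue_measure R) `[0, 1]%classic g = 1 /\
    (forall i, gs i 0 = 0 /\ gs i 1 = 0).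

Definition WB (M : Type) (phi : R -> M -> M) (g : R -> R) (h : M -> R)
    (T : R) (x : M) : R :=
  T^-1 * Rintegral (@lebesgue_measure R) `[0, T]%classic
           (fun t => g (t / T) * h (phi t x)).

(* h \in C^l(M), where the smooth structure on M is the one transported by
   the diffeomorphism Phi : M -> T^d *)
Definition CkM (M : Type) (d : nat) (Phi : M -> 'rV[R]_d) (l : nat) (h : M -> R) :=
  exists H : 'rV[R]_d -> R, periodic H /\ Ck l H /\ forall x, h x = H (Phi x).

Definition CinfM (M : Type) (d : nat) (Phi : M -> 'rV[R]_d) (h : M -> R) :=
  exists H : 'rV[R]_d -> R, periodic H /\ Cinf H /\ forall x, h x = H (Phi x).

(* integral of h w.r.t. mu = pullback of Haar measure under Phi, i.e.
   int_M h dmu = int_{T^d} h (Phi^-1 theta) dtheta; Psi is Phi^-1 *)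
Definition intM (M : Type) (d : nat) (Psi : 'rV[R]_d -> M) (h : M -> R) : R :=
  torus_int (fun v => h (Psi (fracv v))).
End Defs.

(* Main.v *)
Require Import Defs.
From HB Require Import structures.
From mathcomp Require Import all_boot all_order all_algebra.
From mathcomp Require Import all_classical all_reals all_analysis.
From mathcomp Require Import ring lra zify.
Import Order.TTheory GRing.Theory Num.Theory numFieldNormedType.Exports.
Local Open Scope classical_set_scope.
Local Open Scope ring_scope.

(** Replace Fourier series by trigonometric interpolation on the grid
    [(Z/N)^d], [N = 2n+1]: then all sums are finite and no limit is exchanged.
    Let [b_k] be the discrete Fourier coefficients of a periodic [C^l] function
    [H] and [H_n] its interpolant with frequencies [k] in [-n, n]^d.
    Summation by parts [l] times and the mean value theorem give
    [|b_k| <= C |k|^-l] uniformly in [n].  As [l > d], this makes the [H_n]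
    uniformly Hoelder-1/2, so [H_n -> H] uniformly, because they agree on grids
    of mesh [1/N]; integrating over the torus, [b_0 -> \int H].
    For [k <> 0], [m] integrations by parts (the boundary terms vanish) bound the
    weighted average of the mode [k] by a multiple of
    [(T |k.omega|)^-m <= (c T)^-m |k|^(m tau)].  Summing over [k], the error for
    [H_n] is at most [C T^-m \sum_k |k|^(m tau - l)], and the last sum is bounded
    uniformly in [n] since [l - m tau > d].
    To stay over the reals, modes are written as cosines with a free phase. *)

(** * Averages over the grid *)

Section DiscreteFourier.
Set Implicit Arguments.
Unset Strict Implicit.
Variables (R : realType) (d : nat).
Implicit Types (F G : 'rV[R]_d -> R) (x : 'rV[R]_d) (k : 'rV[int]_d) (i : 'I_d).

Lemma cosDint (a : R) (z : int) : cos (a + 2 * pi * z%:~R) = cos a.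
Proof.
have per n b : cos (b + 2 * pi * n%:R) = cos b :> R.
  rewrite (_ : 2 * pi * n%:R = pi *+ 2 *+ n); first by rewrite (periodicn (@cosD2pi R)).
  by rewrite -[RHS]mulr_natr -[pi *+ 2]mulr_natl.
case: z => n; first exact: per.
by rewrite NegzE -[LHS](per n.+1) rmorphN /= mulrN subrK.
Qed.

Lemma zdotD k x y : zdot k (x + y) = zdot k x + zdot k y.
Proof. by rewrite -big_split /=; apply: eq_bigr => i _; rewrite mxE mulrDr. Qed.

Lemma zdotZ k (a : R) x : zdot k (a *: x) = a * zdot k x.
Proof. by rewrite mulr_sumr; apply: eq_bigr => i _; rewrite mxE mulrCA. Qed.

Lemma zdotB k x y : zdot k (x - y) = zdot k x - zdot k y.
Proof. by rewrite zdotD -scaleN1r zdotZ mulN1r. Qed.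

Lemma zdot_evec k i : zdot k (evec R i) = (k 0 i)%:~R.
Proof.
rewrite /zdot (bigD1 i) //= mxE eqxx mulr1 big1 ?addr0 // => j ji.
by rewrite mxE eq_sym (negbTE ji) mulr0.
Qed.

Lemma zdot_int k (z : 'rV[int]_d) :
  zdot k (map_mx (fun z => z%:~R) z) = (\sum_i k 0 i * z 0 i)%:~R :> R.
Proof. by rewrite rmorph_sum /=; apply: eq_bigr => i _; rewrite mxE rmorphM. Qed.

Lemma periodic_cos k (a : R) : Defs.periodic (fun x => cos (2 * pi * zdot k x + a)).
Proof. by move=> x z; rewrite zdotD zdot_int mulrDr addrAC cosDint. Qed.

Lemma periodicM F G :
  Defs.periodic F -> Defs.periodic G -> Defs.periodic (fun x => F x * G x).
Proof. by move=> pF pG x z; rewrite pF pG. Qed.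

(** The mesh is [1/n.+1], so the number of points per axis is never zero. Ordinal coordinates carry
    addition modulo [n.+1], which makes translations of the grid bijective. *)
Definition gpt n (j : 'rV['I_n.+1]_d) : 'rV[R]_d := \row_i ((j 0 i)%:R / n.+1%:R).

Definition avg n F : R := (n.+1%:R ^+ d)^-1 * \sum_(j : 'rV['I_n.+1]_d) F (gpt j).

Lemma card_grid n : #|{: 'rV['I_n.+1]_d}| = (n.+1 ^ d)%N.
Proof. by rewrite card_mx card_ord mul1n. Qed.

Lemma avg_cst n (a : R) : avg n (fun=> a) = a.
Proof.
have E : \sum_(j : 'rV['I_n.+1]_d) a = a *+ (n.+1 ^ d)%N.
  by rewrite -(card_grid n); exact: sumr_const.
by rewrite /avg E -(mulr_natl a) natrX mulKf // expf_neq0 // pnatr_eq0.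
Qed.

Lemma avgD n F G : avg n (fun x => F x + G x) = avg n F + avg n G.
Proof. by rewrite /avg big_split mulrDr. Qed.

Lemma avgZ n (a : R) F : avg n (fun x => a * F x) = a * avg n F.
Proof. by rewrite /avg -mulr_sumr mulrCA. Qed.

Lemma eq_avg n F G : F =1 G -> avg n F = avg n G.
Proof. by move=> FG; congr (_ * _); apply: eq_bigr => j _; rewrite FG. Qed.

Lemma avg_le n F (B : R) : (forall x, `|F x| <= B) -> `|avg n F| <= B.
Proof.
move=> FB; rewrite -(avg_cst n B) /avg normrM ger0_norm; last first.
  by rewrite invr_ge0 exprn_ge0.
rewrite ler_wpM2l ?invr_ge0 ?exprn_ge0 //.
by rewrite (le_trans (ler_norm_sum _ _ _)) // ler_sum.
Qed.

(** Modulo Z^d, a translation by one mesh step along an axis permutes the grid. *)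
Lemma avg_shift n F i : Defs.periodic F ->
  avg n (fun x => F (x + n.+1%:R^-1 *: evec R i)) = avg n F.
Proof.
move=> pF; rewrite /avg; congr (_ * _).
pose e : 'rV['I_n.+1]_d := \row_j (if i == j then inZp 1 else 0).
rewrite [RHS](reindex_inj (addIr e)) /=; apply: eq_bigr => j _.
(* The carry of the modular addition: 1 in coordinate [i] when the shifted point leaves the unit
   cube, 0 otherwise. Periodicity absorbs it. *)
pose q : 'rV[int]_d := \row_l (if i == l then ((j 0%R l + 1) %/ n.+1)%N%:Z else 0).
rewrite -[RHS](pF _ q); congr (F _); apply/rowP => l; rewrite !mxE.
case: (i == l) => /=; last by rewrite mulr0 !addr0 addn0 modn_small.
rewrite modnDmr; set r := n.+1%:R; have r0 : r != 0 :> R by rewrite pnatr_eq0.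
have -> : (j 0 l)%:R =
    ((j 0%R l + 1) %/ n.+1)%N%:R * r + ((j 0%R l + 1) %% n.+1)%N%:R - 1 :> R.
  by rewrite -natrM -natrD -divn_eq natrD addrK.
by field.
Qed.

Definition fdiff (h : R) i F := fun x => F (x + h *: evec R i) - F x.

Lemma periodic_fdiff h i F : Defs.periodic F -> Defs.periodic (fdiff h i F).
Proof. by move=> pF x z; rewrite /fdiff addrAC !pF. Qed.

(** Summation by parts: the shift is moved from [F] onto the cosine by [avg_shift]. The difference
    of the two cosines is again a cosine, with a factor [2 * sin b] and a phase lag [b + pi / 2]. *)
Lemma avg_fdiff n F k i (a : R) : Defs.periodic F ->
  let b := pi * (k 0 i)%:~R / n.+1%:R in
  avg n (fun x => fdiff n.+1%:R^-1 i F x * cos (2 * pi * zdot k x + a)) =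
  2 * sin b * avg n (fun x => F x * cos (2 * pi * zdot k x + (a - (b + pi / 2)))).
Proof.
move=> pF b; pose h := n.+1%:R^-1 : R.
pose G x := F x * cos (2 * pi * zdot k x + (a - 2 * b)).
have pG : Defs.periodic G by apply: periodicM => //; exact: periodic_cos.
transitivity (avg n (fun x => G (x + h *: evec R i)) +
    -1 * avg n (fun x => F x * cos (2 * pi * zdot k x + a))).
  rewrite -avgZ -avgD; apply: eq_avg => x.
  rewrite /fdiff /G -/h mulN1r mulrBl zdotD zdotZ zdot_evec.
  by congr (F _ * cos _ - _); rewrite /b -/h; ring.
rewrite avg_shift // -!avgZ -avgD; apply: eq_avg => x.
rewrite /G mulN1r -mulrBr [RHS]mulrCA; congr (_ * _).
(* The midpoint of the two phases: cos (u - b) - cos (u + b) = 2 sin b sin u, and sin u = cos (u -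
   pi/2). *)
set u := 2 * pi * zdot k x + a - b.
rewrite (_ : _ + (a - 2 * b) = u - b); last by rewrite /u; ring.
rewrite (_ : 2 * pi * zdot k x + a = u + b); last by rewrite /u; ring.
rewrite (_ : _ + (a - _) = u - pi / 2); last by rewrite /u; ring.
by move: u => u; rewrite cosBpihalf cosB cosD; ring.
Qed.

(** The phase on the left is advanced so that the [l] successive lags bring it back to [a]. *)
Lemma avg_fdiff_iter n F k i (a : R) l : Defs.periodic F ->
  let b := pi * (k 0 i)%:~R / n.+1%:R in
  avg n (fun x => iter l (fdiff n.+1%:R^-1 i) F x *
    cos (2 * pi * zdot k x + (a + l%:R * (b + pi / 2)))) =
  (2 * sin b) ^+ l * avg n (fun x => F x * cos (2 * pi * zdot k x + a)).
Proof.
move=> pF b; elim: l a => [|l IH] a.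
  by rewrite mul1r; apply: eq_avg => x; rewrite mul0r addr0.
rewrite /= avg_fdiff; last by elim: l {IH} => //= l; exact: periodic_fdiff.
rewrite exprS -[RHS]mulrA -(IH a) -/b; congr (_ * _); apply: eq_avg => x.
by congr (_ * cos (_ + _)); rewrite -natr1; ring.
Qed.

(* Summation by parts applied to the constant function 1, whose difference is 0. *)
Lemma avg_cos_eq0 n k i (a : R) : sin (pi * (k 0 i)%:~R / n.+1%:R) != 0 :> R ->
  avg n (fun x => cos (2 * pi * zdot k x + a)) = 0.
Proof.
move=> s0; set b := pi * _ / _ in s0.
have := @avg_fdiff n (fun=> 1) k i (a + (b + pi / 2)) (fun _ _ => erefl).
rewrite -/b (@eq_avg _ _ (fun=> 0)); last by move=> x; rewrite /fdiff subrr mul0r.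
rewrite avg_cst => /esym/eqP; rewrite mulf_eq0 mulf_eq0 pnatr_eq0 (negbTE s0) /=.
move/eqP => E; rewrite -[RHS]E; apply: eq_avg => x.
by rewrite mul1r addrK.
Qed.

End DiscreteFourier.

(** * Finite differences of smooth periodic functions *)

Section SmoothPeriodic.
Set Implicit Arguments.
Unset Strict Implicit.
Variables (R : realType) (d : nat).
Implicit Types (F G : 'rV[R]_d -> R) (x : 'rV[R]_d) (i : 'I_d).

Lemma periodic_fracv F x : Defs.periodic F -> F (fracv x) = F x.
Proof.
move=> pF; rewrite -[LHS](pF _ (\row_i Num.floor (x 0 i))); congr F.
by apply/rowP => i; rewrite !mxE subrK.
Qed.

Lemma fracv_fund x : in_fund (fracv x).
Proof.
move=> i; rewrite mxE subr_ge0 ltrBlDr addrC.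
by have := floor_itv (x 0 i); rewrite rmorphD.
Qed.

Lemma periodic_bounded F :
  Defs.periodic F -> continuous F -> exists B : R, forall x, `|F x| <= B.
Proof.
move=> pF cF; pose K := [set v : 'rV[R]_d | forall i, v ord0 i \in `[(0 : R), 1]].
have cK : compact K.
  by apply: (@rV_compact _ _ (fun=> `[(0 : R), 1]%classic)) => _; apply: segment_compact.
have : compact (F @` K) by apply: continuous_compact => //; exact: continuous_subspaceT.
move=> /compact_bounded[M [_ MB]].
have M1 : M < M + 1 by rewrite ltrDl.
exists (M + 1) => x; apply: (MB _ M1).
exists (fracv x); last exact: periodic_fracv.
move=> i; have /andP[a b] := fracv_fund x i.
by rewrite /= in_itv /= a ltW.
Qed.

Lemma derive_shift F (e v : 'rV[R]_d) x :
  'D_e (fun y => F (y + v)) x = 'D_e F (x + v).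
Proof.
rewrite /derive; do 2 f_equal; apply/funext => h /=.
by rewrite addrA.
Qed.

Lemma derivable_shift F (e v : 'rV[R]_d) x :
  derivable F (x + v) e -> derivable (fun y => F (y + v)) x e.
Proof.
rewrite /derivable (_ : (fun h => h^-1 *: ((_ \o shift (x + v)) _ - _)) =
  (fun h => h^-1 *: (((fun y => F (y + v)) \o shift x) (h *: e) - F (x + v)))) //.
by apply/funext => h /=; rewrite addrA.
Qed.

Lemma periodic_derive F (e : 'rV[R]_d) :
  Defs.periodic F -> Defs.periodic (fun x => 'D_e F x).
Proof.
move=> pF x z; rewrite -(derive_shift F e).
by congr ('D_e _ x); apply/funext => y; rewrite pF.
Qed.

Definition dpart i F : 'rV[R]_d -> R := fun x => 'D_(evec R i) F x.

Lemma Ck_continuous l F : Ck l F -> continuous F.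
Proof. by case: l => [|l] // []. Qed.

Lemma Ck_weaken l l' F : (l' <= l)%N -> Ck l F -> Ck l' F.
Proof.
elim: l l' F => [|l IH] [|l'] F //= ll' [cF H] //.
split=> // i; have [dF CF] := H i; split=> //.
exact: IH.
Qed.

Lemma dpart_iter_bounded l F i : Defs.periodic F -> Ck l F ->
  exists B : R, forall x, `|iter l (dpart i) F x| <= B.
Proof.
elim: l F => [|l IH] F pF CF; first exact: periodic_bounded.
have [cF /(_ i)[_ CF']] := CF.
by rewrite iterSr; apply: IH => //; exact: periodic_derive.
Qed.

Lemma is_derive_line F (e : 'rV[R]_d) x (t : R) : derivable F (x + t *: e) e ->
  is_derive t 1 (fun s : R => F (x + s *: e)) ('D_e F (x + t *: e)).
Proof.
have E : (fun h : R => h^-1 *: (F (x + (h *: 1 + t) *: e) - F (x + t *: e))) =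
    (fun h : R => h^-1 *: ((F \o shift (x + t *: e)) (h *: e) - F (x + t *: e))).
  apply/funext => h /=; do 3 f_equal.
  by rewrite scalerDl -scalerA scale1r addrCA addrA addrC addrA.
by move=> dF; apply: DeriveDef; rewrite /derivable /derive /= /shift E.
Qed.

(** Differences are combinations of translates, so they commute with partial derivatives. This
    allows differences to be traded for derivatives one at a time. *)
Lemma derivable_fdiff_iter l (h : R) i F x :
  (forall y, derivable F y (evec R i)) ->
  derivable (iter l (fdiff h i) F) x (evec R i) /\
  'D_(evec R i) (iter l (fdiff h i) F) x = iter l (fdiff h i) (dpart i F) x.
Proof.
move=> dF; elim: l x => [|l IH] x //=.
have d1 := derivable_shift (proj1 (IH (x + h *: evec R i))).
have d2 := proj1 (IH x).
split; first exact: derivableB.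
rewrite [LHS](deriveB d1 d2) derive_shift /fdiff.
by rewrite !(proj2 (IH _)).
Qed.

Lemma fdiff_le (h B : R) i F x : 0 < h ->
  (forall y, derivable F y (evec R i)) -> (forall y, `|dpart i F y| <= B) ->
  `|fdiff h i F x| <= h * B.
Proof.
move=> h0 dF DB.
have dl (t : R) : is_derive t 1 (fun s : R => F (x + s *: evec R i)) (dpart i F (x + t *: evec R i)).
  exact: is_derive_line.
have [|t _] := MVT h0 (fun t _ => dl t).
  by apply: derivable_within_continuous => t _; exact: ex_derive.
rewrite scale0r addr0 subr0 /fdiff => ->.
by rewrite normrM mulrC gtr0_norm // ler_wpM2l // ltW.
Qed.

(** The mean value theorem turns the outermost difference into [h] times a derivative. That
    derivative commutes with the remaining differences, and induction applies to [dpart i F]. *)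
Lemma fdiff_iter_le l (h B : R) i F x : 0 < h -> Ck l F ->
  (forall y, `|iter l (dpart i) F y| <= B) ->
  `|iter l (fdiff h i) F x| <= h ^+ l * B.
Proof.
move=> h0; elim: l F x => [|l IH] F x CF DB; first by rewrite mul1r; exact: DB.
have [_ /(_ i)[dF CF']] := CF.
rewrite exprS -mulrA /=; apply: fdiff_le => // y.
  exact: (proj1 (derivable_fdiff_iter _ _ _ dF)).
rewrite /dpart (proj2 (derivable_fdiff_iter _ _ _ dF)).
by apply: IH => // z; rewrite -iterSr.
Qed.

(* Lipschitz for the l^1 distance, which restricts well to slices. *)
Definition lip (K : R) F := forall x y, `|F x - F y| <= K * \sum_i `|x 0 i - y 0 i|.

Lemma Ck1_lip F : Defs.periodic F -> Ck 1 F -> exists2 K : R, 0 <= K & lip K F.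
Proof.
move=> pF [cF dF].
have /choice[B HB] : forall i, exists B, forall x, `|dpart i F x| <= B.
  by move=> i; apply: (@dpart_iter_bounded 1).
have B0 i : 0 <= B i by exact: le_trans (HB i 0).
have K0 : 0 <= \sum_i B i by apply: sumr_ge0.
exists (\sum_i B i) => // x y.
have step i (a : R) z : `|F (z + a *: evec R i) - F z| <= B i * `|a|.
  have pos a' z' : 0 < a' -> `|F (z' + a' *: evec R i) - F z'| <= B i * `|a'|.
    move=> a0; rewrite (gtr0_norm a0) mulrC; apply: fdiff_le => //.
    by case: (dF i).
  case: (ltrgtP a 0) => [a0|/pos//|->]; last by rewrite scale0r addr0 subrr !normr0 mulr0.
  rewrite distrC -(normrN a) -[X in F X - _](addrK (a *: evec R i)) -scaleNr.
  by apply: pos; rewrite oppr_gt0.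
(* A path from [y] to [x] that changes one coordinate at a time: the first [k] coordinates are
   already those of [x]. *)
pose z k : 'rV[R]_d := \row_j (if (j < k)%N then x 0 j else y 0 j).
have -> : F x - F y = \sum_(k < d) (F (z k.+1) - F (z k)).
  transitivity (\sum_(0 <= k < d) (F (z k.+1) - F (z k))); last by rewrite big_mkord.
  rewrite (telescope_sumr (fun k => F (z k))) //; congr (F _ - F _).
    by apply/rowP => j; rewrite mxE ltn_ord.
  by apply/rowP => j; rewrite mxE.
rewrite (le_trans (ler_norm_sum _ _ _)) // mulr_sumr ler_sum // => k _.
have -> : z k.+1 = z k + (x 0 k - y 0 k) *: evec R k.
  apply/rowP => j; rewrite !mxE ltnS leq_eqVlt eq_sym.
  case: (altP (k =P j)) => [->|kj]; first by rewrite eqxx ltnn mulr1 addrC subrK.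
  by rewrite (_ : (k == j :> nat) = false) ?mulr0 ?addr0 //; apply/negbTE.
rewrite (le_trans (step _ _ _)) // ler_wpM2r //.
by rewrite (bigD1 k) //= lerDl sumr_ge0.
Qed.

End SmoothPeriodic.

(** * Sums over lattice boxes *)

Section LatticeSums.
Set Implicit Arguments.
Unset Strict Implicit.
Variables (R : realType) (d : nat).

Lemma powR_decr (a b p : R) : 0 < a -> a <= b -> 0 <= p -> b `^ (- p) <= a `^ (- p).
Proof.
move=> a0 ab p0; rewrite !powRN lef_pV2 ?posrE ?powR_gt0 //; last exact: lt_le_trans ab.
by apply: ge0_ler_powR; rewrite ?nnegrE // ltW // (lt_le_trans a0).
Qed.

(** Comparison with a telescoping sum: the mean value theorem for t^(-q), [q = p - 1], on [j, j+1]
    dominates each term beyond the first by a difference of consecutive values divided by [q]. *)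
Lemma pseries_bounded (p : R) : 1 < p ->
  exists C : R, forall n, \sum_(0 <= j < n) (j.+1%:R : R) `^ (- p) <= C.
Proof.
move=> p1; pose q := p - 1; have q0 : 0 < q by rewrite subr_gt0.
have step (j : nat) : (0 < j)%N ->
    (j.+1%:R : R) `^ (- p) <= q^-1 * (j%:R `^ (- q) - j.+1%:R `^ (- q)).
  move=> j0; have jj : j%:R < j.+1%:R :> R by rewrite ltr_nat.
  have jp : 0 < j%:R :> R by rewrite ltr0n.
  have D (x : R) : j%:R <= x -> is_derive x 1 ((@powR R)^~ (- q)) (- q * x `^ (- q - 1)).
    by move=> jx; apply: is_derive1_powR; exact: lt_le_trans jx.
  have [||c] := MVT (f := (@powR R)^~ (- q)) (df := fun x => - q * x `^ (- q - 1)) jj.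
  - by move=> x /[!in_itv] /= /andP[jx _]; apply: D; exact: ltW.
  - apply: derivable_within_continuous => x /[!in_itv] /= /andP[jx _].
    by apply: ex_derive; exact: D.
  rewrite in_itv /= => /andP[jc cj] E.
  have -> : j%:R `^ (- q) - j.+1%:R `^ (- q) = q * c `^ (- p) :> R.
    rewrite -opprB E -natr1 addrAC subrr add0r mulr1 mulNr opprK.
    by congr (_ * _ `^ _); rewrite /q; ring.
  rewrite mulKf ?gt_eqF //; apply: powR_decr; rewrite ?(lt_trans jp) // ltW //.
  by rewrite (lt_trans ltr01).
exists (1 + q^-1) => -[|n].
  by rewrite big_geq // addr_ge0 // invr_ge0 ltW.
rewrite big_nat_recl //= powR1 lerD2l.
have : \sum_(0 <= j < n) (j.+2%:R : R) `^ (- p) <=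
    \sum_(0 <= j < n) q^-1 * (j.+1%:R `^ (- q) - j.+2%:R `^ (- q)).
  by apply: ler_sum => j _; exact: step.
move/le_trans; apply; rewrite -mulr_sumr ler_piMr ?invr_ge0 ?(ltW q0) //.
have -> : \sum_(0 <= j < n) (j.+1%:R `^ (- q) - j.+2%:R `^ (- q)) =
    1 - n.+1%:R `^ (- q) :> R.
  rewrite -[LHS]opprK -sumrN.
  rewrite (eq_bigr (fun j => j.+2%:R `^ (- q) - j.+1%:R `^ (- q))); last first.
    by move=> j _; rewrite opprB.
  rewrite (telescope_sumr (fun j => j.+1%:R `^ (- q) : R)) // opprB.
  by rewrite powR1.
by rewrite gerBl powR_ge0.
Qed.

(** The maximum with 1 gives a zero coordinate weight 1; with [p > 0], [powR] at 0 would give 0 and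
    the product over coordinates would vanish. *)
Definition wgt (p : R) (z : int) : R := Num.max 1 `|z%:~R| `^ (- p).

Lemma wgt_sum_bounded (p : R) : 1 < p ->
  exists C : R, forall n, \sum_(a < n.*2.+1) wgt p (a%:Z - n%:Z) <= C.
Proof.
(* The three summands bound the negative, zero and positive integers respectively. *)
move=> /pseries_bounded[C HC]; exists (C + (1 + C)) => n.
have wS (j : nat) z : `|z| = j.+1%:R -> wgt p z = j.+1%:R `^ (- p).
  move=> zE; rewrite /wgt -intr_norm zE; congr (_ `^ _).
  by rewrite mulrz_nat max_r // ler1n.
rewrite -(big_mkord xpredT (fun a : nat => wgt p (a%:Z - n%:Z))).
rewrite (big_cat_nat _ (n := n)) //=; last by rewrite -addnn; lia.
apply: lerD.
  rewrite big_nat_rev /= (le_trans _ (HC n)) // big_nat [leRHS]big_nat.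
  by apply: ler_sum => a /andP[_ an]; rewrite (wS a) //; lia.
rewrite -{1}(add0n n) big_addn (_ : (n.*2.+1 - n)%N = n.+1); last by lia.
rewrite big_nat_recl //; apply: lerD.
  by rewrite /wgt add0n subrr normr0 max_l ?ler01 // powR1.
rewrite (le_trans _ (HC n)) //.
by apply: ler_sum => a _; rewrite (wS a) //; lia.
Qed.

(* The representatives of (Z/(2n+1))^d in [-n, n]^d; the factor |k_i| <= N/2 is what
   makes sin (pi k_i / N) comparable to k_i / N. *)
Definition kvec n (j : 'rV['I_(n.*2.+1)]_d) : 'rV[int]_d :=
  \row_i ((j 0 i)%:Z - n%:Z).

Lemma le_znorm (k : 'rV[int]_d) i : `|(k 0 i)%:~R| <= znorm R k.
Proof. by rewrite /znorm (le_bigmax _ (fun i => `|(k 0 i)%:~R : R|)). Qed.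

Lemma znorm_ge1 (k : 'rV[int]_d) : k != 0 -> 1 <= znorm R k.
Proof.
move=> /rV0Pn[i ki]; apply: le_trans (le_znorm k i).
by rewrite -intr_norm ler1z -gtz0_ge1 normr_gt0.
Qed.

Lemma znorm_eq (k : 'rV[int]_d) : k != 0 -> exists i, znorm R k = `|(k 0 i)%:~R|.
Proof.
move=> /rV0Pn[i0 _].
have [i _ imax] := arg_maxP (fun i => `|(k 0 i)%:~R : R|) (erefl : xpredT i0).
exists i; apply/le_anti; rewrite le_znorm andbT.
by apply: bigmax_le => // j _; exact: imax.
Qed.

Lemma lattice_sum_bounded (s : R) : (0 < d)%N -> d%:R < s ->
  exists2 C : R, 0 <= C & forall n,
    \sum_(j : 'rV['I_(n.*2.+1)]_d | kvec j != 0) znorm R (kvec j) `^ (- s) <= C.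
Proof.
(* The exponent is shared equally among the coordinates: [s > d] says exactly that [p > 1], so the
   one-dimensional sums stay bounded. *)
move=> d0 ds; pose p := s / d%:R.
have dp : 0 < d%:R :> R by rewrite ltr0n.
have p1 : 1 < p by rewrite /p ltr_pdivlMr // mul1r.
have p0 : 0 <= p by rewrite (le_trans ler01) // ltW.
have [C HC] := wgt_sum_bounded p1.
have w0 z : 0 <= wgt p z by exact: powR_ge0.
have C0 : 0 <= C by apply: le_trans (HC 0); exact: sumr_ge0.
exists (C ^+ d) => [|n]; first exact: exprn_ge0.
(* max(1,|k_i|) <= |k| for each i, so the sum is dominated by a product of 1D sums. *)
have le1 j : kvec j != 0 :> 'rV[int]_d ->
    znorm R (kvec (n := n) j) `^ (- s) <= \prod_i wgt p (kvec j 0 i).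
  move=> k0; have z1 := znorm_ge1 k0.
  have -> : - s = - p * d%:R by rewrite /p mulNr divfK // gt_eqF.
  rewrite powRrM powR_mulrn ?powR_ge0 // -[X in _ ^+ X](card_ord d) -prodr_const.
  apply: ler_prod => i _; rewrite powR_ge0; apply: powR_decr => //.
  by rewrite ge_max z1 le_znorm.
have : \sum_(j : 'rV['I_(n.*2.+1)]_d) \prod_i wgt p (kvec j 0 i) <= C ^+ d.
  (* Row vectors are reindexed as finite functions, so that the sum of products distributes into a
     product of sums. *)
  pose G (f : {ffun 'I_d -> 'I_(n.*2.+1)}) : 'rV['I_(n.*2.+1)]_d := \row_i f i.
  rewrite (reindex G) /=; last first.
    exists (fun j : 'rV_d => [ffun i => j 0 i]) => [f|j] _.
      by apply/ffunP => i; rewrite ffunE mxE.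
    by apply/rowP => i; rewrite mxE ffunE.
  rewrite (eq_bigr (fun f : {ffun 'I_d -> 'I_(n.*2.+1)} => \prod_i wgt p ((f i)%:Z - n%:Z))); last first.
    by move=> f _; apply: eq_bigr => i _; rewrite !mxE.
  rewrite -(bigA_distr_bigA (fun (_ : 'I_d) (a : 'I_(n.*2.+1)) => wgt p (a%:Z - n%:Z))).
  rewrite prodr_const card_ord; apply: lerXn2r; rewrite ?nnegrE //.
  exact: sumr_ge0.
apply: le_trans; rewrite [leRHS](bigID (fun j => kvec j != 0)) /=.
rewrite ler_wpDr //; last exact: ler_sum.
by apply: sumr_ge0 => j _; exact: prodr_ge0.
Qed.

End LatticeSums.

(** * Elementary bounds and derivatives for sine and cosine *)

Section Trig.
Set Implicit Arguments.
Unset Strict Implicit.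
Variable R : realType.
Implicit Types x y : R.

(** For x > 0 the mean value theorem on [0, x/2] gives sin (x/2) >= (x/2) cos (x/2), hence sin x >=
    x cos^2 (x/2) = x (1 + cos x)/2 >= x/2. *)
Lemma norm_sin_ge x : `|x| <= pi / 2 -> `|x| <= 2 * `|sin x|.
Proof.
wlog x0 : x / 0 <= x => [H|].
  have [/H//|x0] := leP 0 x.
  by rewrite -(normrN x) -(normrN (sin x)) -sinN; apply: H; rewrite oppr_ge0 ltW.
rewrite (ger0_norm x0) => xp; move: x0; rewrite le_eqVlt => /predU1P[<-|x0].
  by rewrite mulr_ge0.
have h0 : 0 < x / 2 by rewrite divr_gt0.
have [|c] := MVT h0 (fun t _ => is_derive_sin t).
  by apply: derivable_within_continuous => t _; exact: ex_derive.
rewrite sin0 !subr0 in_itv /= => /andP[c0 cx] E.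
have pi0 := @pi_gt0 R.
have cc : cos (x / 2) <= cos c.
  by rewrite ltW // ltr_cos // in_itv /=; apply/andP; split; lra.
have c2 : 0 <= cos (x / 2) by apply: cos_ge0_pihalf; apply/andP; split; lra.
have cx0 : 0 <= cos x by apply: cos_ge0_pihalf; apply/andP; split; lra.
have Ec : cos x = 2 * cos (x / 2) ^+ 2 - 1.
  rewrite {1}(splitr x) cosD -!expr2 sin2cos2; ring.
have Es : sin x = 2 * (cos c * (x / 2)) * cos (x / 2).
  rewrite -E {1}(splitr x) sinD; ring.
have : x * cos (x / 2) ^+ 2 <= sin x.
  rewrite Es (_ : 2 * _ * _ = x * (cos (x / 2) * cos c)); last by field.
  by rewrite ler_wpM2l ?(ltW x0) // expr2 ler_wpM2l.
move=> xs; apply: (le_trans _ (ler_wpM2l _ (ler_norm _))) => //.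
apply: le_trans (ler_wpM2l _ xs) => //; nra.
Qed.

Lemma cos_dist x y : `|cos x - cos y| <= `|x - y|.
Proof.
wlog xy : x y / y <= x => [H|].
  by have [/H//|/ltW/H] := leP y x; rewrite distrC (distrC y).
have [c _ ->] := MVT_segment xy (fun t _ => is_derive_cos t)
  (derivable_within_continuous (fun t _ => @ex_derive _ _ _ _ _ _ _ (is_derive_cos t))).
by rewrite normrM normrN ler_piMl // sin_max.
Qed.

(** The geometric mean of the Lipschitz bound and the trivial bound 2. It costs only half a power of
    the frequency, which an integer [l > d] can afford. *)
Lemma cos_dist_sqrt x y : `|cos x - cos y| <= Num.sqrt (2 * `|x - y|).
Proof.
rewrite -(ger0_norm (normr_ge0 (cos x - cos y))) -sqrtr_sqr ler_wsqrtr // expr2.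
rewrite ler_pM ?cos_dist //.
by rewrite (le_trans (ler_normB _ _)) // -[2]/(1 + 1) lerD ?cos_max.
Qed.

Lemma is_derive_affine (f : R -> R) (w a x df : R) :
  is_derive (w * x + a) 1 f df -> is_derive x 1 (fun y => f (w * y + a)) (w * df).
Proof.
move=> Df.
have Dl : is_derive x 1 (fun y : R => w * y + a) w.
  have := is_deriveD (is_deriveZ w (is_derive_id x (1 : R))) (is_derive_cst a x (1 : R)).
  by rewrite addr0 [_ *: _]mulr1.
by rewrite mulrC; exact: (@is_derive1_comp _ f (fun y => w * y + a) x _ _ Df Dl).
Qed.

Lemma derivable_oo_LRcontinuousW (f df : R -> R) (a b : R) :
  (forall x, is_derive x 1 f (df x)) -> derivable_oo_LRcontinuous f a b.
Proof.
move=> Df; have cf : continuous f.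
  move=> x; apply/differentiable_continuous/derivable1_diffP.
  exact: ex_derive.
split; first by move=> x _; exact: ex_derive.
  exact: cvg_at_right_filter (cf a).
exact: cvg_at_left_filter (cf b).
Qed.

End Trig.

(** * Trigonometric interpolation *)

Section Interpolation.
Set Implicit Arguments.
Unset Strict Implicit.
Variables (R : realType) (d : nat).
Implicit Types (F G : 'rV[R]_d -> R) (x y : 'rV[R]_d) (k : 'rV[int]_d) (i : 'I_d).

(** The real part of e^(ia) b_k, with b_k the discrete Fourier coefficient. The phase
    [a = 2 * pi * zdot k x] gives the contribution of the mode [k] at [x]. *)
Definition fcoef n F k (a : R) : R :=
  avg n (fun y => F y * cos (a - 2 * pi * zdot k y)).

Lemma fcoef_phase n F k a :
  fcoef n F k a = cos a * fcoef n F k 0 + sin a * fcoef n F k (pi / 2).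
Proof.
rewrite -!avgZ -avgD; apply: eq_avg => y.
rewrite cosB (cosB 0) (cosB (pi / 2)) cos0 sin0 cos_pihalf sin_pihalf; ring.
Qed.

Lemma fcoef_dist n F k (B a b : R) : (forall a, `|fcoef n F k a| <= B) ->
  `|fcoef n F k a - fcoef n F k b| <= 2 * B * Num.sqrt (2 * `|a - b|).
Proof.
move=> HB; have B0 : 0 <= B by exact: le_trans (HB 0).
rewrite (fcoef_phase _ _ _ a) (fcoef_phase _ _ _ b).
have -> (c e s t u v : R) : c * e + s * t - (u * e + v * t) = (c - u) * e + (s - v) * t.
  by ring.
rewrite (le_trans (ler_normD _ _)) // !(normrM (_ - _)).
rewrite (_ : 2 * B * _ = Num.sqrt (2 * `|a - b|) * B + Num.sqrt (2 * `|a - b|) * B); last by ring.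
apply: lerD; apply: ler_pM => //; first exact: cos_dist_sqrt.
rewrite -(cosBpihalf a) -(cosBpihalf b) (le_trans (cos_dist_sqrt _ _)) //.
by rewrite opprB addrA subrK.
Qed.

(** With N = [n.+1], the condition |k_i| <= N/2 puts [b] in [-pi/2, pi/2], so 2 |sin b| >= |b| >=
    |k_i|/N. The resulting N^(-l) cancels the mesh factor of the [l]-th difference. *)
Lemma fcoef_le n F k i l (B a : R) :
  Defs.periodic F -> Ck l F -> (forall y, `|iter l (dpart i) F y| <= B) ->
  `|(k 0 i)%:~R : R| <= n.+1%:R / 2 ->
  `|(k 0 i)%:~R| ^+ l * `|fcoef n F k a| <= B.
Proof.
move=> pF CF DB kn; set b := pi * (k 0 i)%:~R / n.+1%:R : R.
have N0 : 0 < n.+1%:R :> R by rewrite ltr0n.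
have bE : `|b| = pi * `|(k 0 i)%:~R| / n.+1%:R.
  by rewrite !normrM normfV (gtr0_norm N0) (ger0_norm (pi_ge0 R)).
have bp : `|b| <= pi / 2.
  rewrite bE -mulrA ler_wpM2l ?pi_ge0 // ler_pdivrMr //.
  by rewrite mulrC.
have -> : fcoef n F k a = avg n (fun y => F y * cos (2 * pi * zdot k y + - a)).
  by apply: eq_avg => y; rewrite -cosN opprB addrC.
set A := avg _ _.
have : `|(2 * sin b) ^+ l * A| <= n.+1%:R^-1 ^+ l * B.
  rewrite -(avg_fdiff_iter n k i (- a) l pF); apply: avg_le => x.
  rewrite normrM -[leRHS]mulr1 ler_pM ?cos_max //.
  by apply: fdiff_iter_le => //; rewrite invr_gt0.
rewrite normrM normrX normrM (ger0_norm (ler0n _ 2)) => le1.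
have le2 : `|b| ^+ l * `|A| <= n.+1%:R^-1 ^+ l * B.
  apply: le_trans le1; rewrite ler_wpM2r // lerXn2r ?nnegrE ?mulr_ge0 //.
  exact: norm_sin_ge.
have le3 : (`|(k 0 i)%:~R : R| / n.+1%:R) ^+ l * `|A| <= n.+1%:R^-1 ^+ l * B.
  apply: le_trans le2; rewrite ler_wpM2r // lerXn2r ?nnegrE ?divr_ge0 //.
  rewrite bE ler_wpM2r ?invr_ge0 ?(ltW N0) // ler_peMl //.
  by rewrite (le_trans _ (pi_ge2 R)) // ler1n.
by move: le3; rewrite exprMn [X in X * _]mulrC -mulrA ler_pM2l.
Qed.

Lemma kvec_le n (j : 'rV['I_(n.*2.+1)]_d) i :
  `|(kvec j 0 i)%:~R : R| <= n.*2.+1%:R / 2.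
Proof.
rewrite ler_pdivlMr // -intr_norm mxE -[2]/(2%:R) -!pmulrn -natrM ler_nat.
have := ltn_ord (j 0 i); lia.
Qed.

Lemma fcoef_decay F l : Defs.periodic F -> Ck l F ->
  exists2 C : R, 0 <= C & forall n (j : 'rV['I_(n.*2.+1)]_d) a, kvec j != 0 ->
    `|fcoef n.*2 F (kvec j) a| <= C * znorm R (kvec j) `^ (- l%:R).
Proof.
move=> pF CF.
have /choice[B HB] : forall i, exists B, forall x, `|iter l (dpart i) F x| <= B.
  by move=> i; exact: dpart_iter_bounded.
have B0 i : 0 <= B i by exact: le_trans (HB i 0).
exists (\sum_i B i) => [|n j a k0]; first exact: sumr_ge0.
have z0 := lt_le_trans ltr01 (znorm_ge1 R k0).
rewrite powRN powR_mulrn ?(ltW z0) // ler_pdivlMr ?exprn_gt0 //.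
(* Parts are taken along a coordinate realizing the norm; it varies with [k], hence the sum of all
   [B i] as the constant. *)
have [i zi] := znorm_eq R k0; rewrite zi mulrC.
rewrite (le_trans (fcoef_le a pF CF (HB i) (kvec_le j i))) //.
by rewrite (bigD1 i) //= lerDl sumr_ge0.
Qed.

Definition interp n F x : R :=
  \sum_(j : 'rV['I_(n.*2.+1)]_d) fcoef n.*2 F (kvec j) (2 * pi * zdot (kvec j) x).

Lemma kvec_inj n : injective (@kvec d n).
Proof.
move=> j j' /rowP E; apply/rowP => i; apply/val_inj.
by have := E i; rewrite !mxE => /addIr[].
Qed.

Lemma zdot0 x : zdot 0 x = 0.
Proof. by apply: big1 => i _; rewrite mxE mul0r. Qed.

Lemma interpE n F x : interp n F x = avg n.*2 F +
  \sum_(j : 'rV['I_(n.*2.+1)]_d | kvec j != 0)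
    fcoef n.*2 F (kvec j) (2 * pi * zdot (kvec j) x).
Proof.
have nn : (n < n.*2.+1)%N by rewrite -addnn; lia.
pose j0 : 'rV['I_(n.*2.+1)]_d := const_mx (Ordinal nn).
have k0 : kvec j0 = 0 by apply/rowP => i; rewrite !mxE subrr.
rewrite /interp (bigD1 j0) //=; congr (_ + _).
  by rewrite k0; apply: eq_avg => y; rewrite !zdot0 mulr0 subrr cos0 mulr1.
by apply: eq_bigl => j; rewrite -k0 (inj_eq (@kvec_inj n)).
Qed.

Lemma sin_natdiv_neq0 n (q : int) : q != 0 -> `|q| < n.+1%:Z ->
  sin (pi * q%:~R / n.+1%:R) != 0 :> R.
Proof.
wlog q0 : q / 0 < q => [H q0 qn|_ qn].
  have := q0; rewrite neq_lt => /orP[qlt|qgt]; last exact: H.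
  rewrite -[q]opprK rmorphN mulrN mulNr sinN oppr_eq0.
  by apply: H; rewrite ?oppr_gt0 ?oppr_eq0 ?normrN.
have N0 : 0 < n.+1%:R :> R by rewrite ltr0n.
apply/lt0r_neq0/sin_gt0_pi; rewrite divr_gt0 ?mulr_gt0 ?pi_gt0 ?ltr0z //=.
rewrite ltr_pdivrMr // ltr_pM2l ?pi_gt0 // pmulrn ltr_int.
by move: qn; rewrite gtr0_norm.
Qed.

(** Discrete orthogonality. After the sums are exchanged, the frequencies run over a translated
    grid, so the inner sum is itself a grid average of a cosine, now with frequency [j - i]. *)
Lemma interp_gpt n F (j : 'rV['I_(n.*2.+1)]_d) : interp n F (gpt R j) = F (gpt R j).
Proof.
rewrite /interp /fcoef /avg -mulr_sumr exchange_big /= mulr_sumr (bigD1 j) //=.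
have E (i : 'rV['I_(n.*2.+1)]_d) : (n.*2.+1%:R ^+ d)^-1 *
    \sum_(j' : 'rV['I_(n.*2.+1)]_d) F (gpt R i) *
       cos (2 * pi * zdot (kvec j') (gpt R j) - 2 * pi * zdot (kvec j') (gpt R i)) =
    F (gpt R i) * (i == j)%:R.
  rewrite -mulr_sumr mulrCA; congr (_ * _).
  pose q : 'rV[int]_d := \row_l ((j 0 l)%:Z - (i 0 l)%:Z).
  (* The constant phase produced by the offset [- n] in [kvec]. *)
  pose a : R := - (2 * pi * (n%:R / n.*2.+1%:R) * \sum_l (q 0 l)%:~R).
  transitivity (avg n.*2 (fun y => cos (2 * pi * zdot q y + a))).
    congr (_ * _); apply: eq_bigr => j' _; congr cos.
    rewrite -mulrBr -zdotB /a -[X in _ = _ - X]mulrA -mulrBr; congr (_ * _).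
    rewrite /zdot [X in _ = _ - X]mulr_sumr -sumrB; apply: eq_bigr => l _; rewrite !mxE.
    rewrite !rmorphB /= -!pmulrn; ring.
  have [ij|ij] := eqVneq i j.
    rewrite (@eq_avg _ _ _ _ (fun=> 1)) ?avg_cst // => y.
    have q0 : q = 0 by apply/rowP => l; rewrite !mxE ij subrr.
    have S0 : \sum_l (q 0 l)%:~R = 0 :> R by apply: big1 => l _; rewrite q0 mxE.
    by rewrite /a S0 q0 zdot0 !mulr0 oppr0 addr0 cos0.
  have /rV0Pn[l ql] : q != 0.
    apply: contra_neq ij => q0; apply/rowP => l; apply/val_inj.
    by move/rowP: q0 => /(_ l); rewrite !mxE => /eqP; rewrite subr_eq0 => /eqP[].
  apply: (@avg_cos_eq0 _ _ _ _ l); apply: sin_natdiv_neq0 => //.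
  rewrite mxE; have := ltn_ord (j 0 l); have := ltn_ord (i 0 l); lia.
rewrite E eqxx mulr1 big1 ?addr0 // => i /negbTE ij.
by rewrite E ij mulr0.
Qed.

Lemma interp_periodic n F : Defs.periodic (interp n F).
Proof.
move=> x z; apply: eq_bigr => j _; apply: eq_avg => y; congr (_ * _).
by rewrite zdotD zdot_int mulrDr addrAC cosDint.
Qed.

(** By [cos_dist_sqrt], the mode [k] varies by at most a multiple of |k|^(-l) (|k| e)^(1/2). These
    terms have bounded sums because l - 1/2 > d, and the bound does not depend on [n]. *)
Lemma interp_hoelder F l : (d < l)%N -> Defs.periodic F -> Ck l F ->
  exists2 K : R, 0 <= K & forall n x y (e : R), (forall i, `|x 0 i - y 0 i| <= e) ->
    `|interp n F x - interp n F y| <= K * Num.sqrt e.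
Proof.
case: (posnP d) => [d0 _ _ _|dgt0 dl pF CF].
  exists 0 => // n x y e _; rewrite mul0r (_ : x = y) ?subrr ?normr0 //.
  by apply/rowP => i; have := ltn_ord i; rewrite [X in (_ < X)%N]d0.
have [C C0 HC] := fcoef_decay pF CF.
have [|S S0 HS] := @lattice_sum_bounded R d (l%:R - 2^-1) dgt0.
  by rewrite ltrBrDr (@lt_le_trans _ _ (d%:R + 1)) ?ltrD2l ?natr1 ?ler_nat //; lra.
(* Under the root: 2 from [cos_dist_sqrt], 2 pi from the phase, and [d] from |k.(x - y)| <= d |k|
   e. *)
exists (2 * C * Num.sqrt (4 * pi * d%:R) * S) => [|n x y e xy].
  by rewrite !mulr_ge0 // sqrtr_ge0.
have e0 : 0 <= e by apply: le_trans (xy (Ordinal dgt0)).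
rewrite !interpE opprD addrACA subrr add0r -sumrB.
rewrite (le_trans (ler_norm_sum _ _ _)) //.
have -> : 2 * C * Num.sqrt (4 * pi * d%:R) * S * Num.sqrt e =
  2 * C * Num.sqrt (4 * pi * d%:R * e) * S.
  by rewrite [in RHS]sqrtrM ?mulr_ge0 ?pi_ge0 //; ring.
apply: le_trans (ler_wpM2l _ (HS n)); last by rewrite !mulr_ge0 // sqrtr_ge0.
rewrite mulr_sumr; apply: ler_sum => j k0.
have z0 := lt_le_trans ltr01 (znorm_ge1 R k0).
rewrite (le_trans (fcoef_dist _ _ (fun a => HC n j a k0))) //.
set z := znorm R _ in z0 *.
have -> : 2 * C * Num.sqrt (4 * pi * d%:R * e) * z `^ (- (l%:R - 2^-1)) =
    2 * (C * z `^ (- l%:R)) * Num.sqrt (4 * pi * d%:R * e * z).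
  rewrite (sqrtrM z) ?mulr_ge0 ?pi_ge0 // -(powR12_sqrt (ltW z0)) opprB addrC powRD; last first.
    by rewrite (gt_eqF z0) implybT.
  ring.
rewrite ler_wpM2l ?mulr_ge0 ?powR_ge0 // ler_wsqrtr //.
rewrite -mulrBr -zdotB !normrM (ger0_norm (pi_ge0 R)) (ger0_norm (ler0n _ 2)).
have : `|zdot (kvec j) (x - y)| <= d%:R * (z * e).
  rewrite (le_trans (ler_norm_sum _ _ _)) //.
  have -> : d%:R * (z * e) = \sum_(i < d) z * e.
    by rewrite sumr_const card_ord mulr_natl.
  apply: ler_sum => i _; rewrite normrM ler_pM //; first exact: le_znorm.
  by rewrite !mxE.
move=> le1; have p0 := pi_ge0 R.
rewrite (_ : 4 * pi * d%:R * e * z = 2 * (2 * pi * (d%:R * (z * e)))); last by ring.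
by rewrite !ler_wpM2l // mulr_ge0.
Qed.

Lemma grid_near n x : in_fund x ->
  exists j : 'rV['I_n.+1]_d, forall i, `|x 0 i - gpt R j 0 i| <= n.+1%:R^-1.
Proof.
move=> fx; have N0 : 0 < n.+1%:R :> R by rewrite ltr0n.
exists (\row_i inord (Num.truncn (n.+1%:R * x 0 i))) => i; rewrite !mxE.
have /andP[x0 x1] := fx i; have Nx : 0 <= n.+1%:R * x 0 i by rewrite mulr_ge0.
have /andP[t0 t1] := truncn_itv Nx.
rewrite inordK; last first.
  by rewrite -(ltr_nat R) (le_lt_trans t0) // gtr_pMr.
set t : R := (Num.truncn _)%:R in t0 t1 *.
have -> : x 0 i - t / n.+1%:R = (n.+1%:R * x 0 i - t) / n.+1%:R.
  by rewrite mulrBl [n.+1%:R * _]mulrC mulfK // gt_eqF.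
rewrite ger0_norm; last by rewrite divr_ge0 ?(ltW N0) // subr_ge0.
by rewrite ler_piMl ?invr_ge0 ?(ltW N0) // lerBlDr addrC natr1 ltW.
Qed.

(** [F] and its interpolant agree at a grid point within 1/N of [x] modulo Z^d, and neither moves
    much from there: one is Lipschitz, the other uniformly Hoelder. *)
Lemma interp_cvg F l (eps : R) : (d < l)%N -> Defs.periodic F -> Ck l F -> 0 < eps ->
  exists n, forall x, `|interp n F x - F x| <= eps.
Proof.
move=> dl pF CF eps0.
have [K K0 HK] := interp_hoelder dl pF CF.
have C1 : Ck 1 F by apply: Ck_weaken CF; exact: leq_ltn_trans dl.
have [L L0 HL] := Ck1_lip pF C1.
pose A := K + L * d%:R; have A0 : 0 <= A by rewrite addr_ge0 // mulr_ge0.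
(* This makes N >= (A/eps)^2. The Lipschitz term, of order 1/N, is absorbed since 1/N <=
   N^(-1/2). *)
pose n := Num.truncn ((A / eps) ^+ 2); exists n => x.
set N : R := n.*2.+1%:R; have N0 : 0 < N by rewrite ltr0n.
have N1 : 1 <= N by rewrite ler1n.
have NA : A * Num.sqrt N^-1 <= eps.
  rewrite sqrtrV ?(ltW N0) // ler_pdivrMr ?sqrtr_gt0 // mulrC -ler_pdivrMr //.
  rewrite -(@ger0_norm _ (A / eps)) ?divr_ge0 ?(ltW eps0) // -sqrtr_sqr ler_wsqrtr //.
  have /andP[_ /ltW t1] := truncn_itv (sqr_ge0 (A / eps)).
  by rewrite (le_trans t1) // ler_nat -/n -addnn; lia.
apply: le_trans NA.
have [j Hj] := grid_near n.*2 (fracv_fund x).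
rewrite -(periodic_fracv _ pF) -(periodic_fracv _ (interp_periodic n F)).
rewrite -(subrKA (interp n F (gpt R j))) interp_gpt.
rewrite (le_trans (ler_normD _ _)) // mulrDl lerD //; first by rewrite -(interp_gpt F j) HK.
rewrite distrC (le_trans (HL _ _)) // -mulrA ler_wpM2l //.
apply: (@le_trans _ _ (\sum_(i < d) N^-1)); first by apply: ler_sum => i _; exact: Hj.
rewrite sumr_const card_ord -[leLHS]mulr_natl ler_wpM2l //.
rewrite -[leLHS]sqr_sqrtr ?invr_ge0 ?(ltW N0) // expr2 ler_piMl ?sqrtr_ge0 //.
by rewrite -sqrtr1 ler_wsqrtr // invf_le1.
Qed.

End Interpolation.

(** * Iterated integrals over the torus *)

Section TorusIntegral.
Set Implicit Arguments.
Unset Strict Implicit.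
Variable R : realType.
Local Notation mu := (@lebesgue_measure R).

Lemma segment_integrable (a b : R) (u : R -> R) :
  {within `[a, b], continuous u} -> mu.-integrable `[a, b] (EFin \o u).
Proof. by move=> cu; apply: continuous_compact_integrable => //; exact: segment_compact. Qed.

Lemma continuous_integrable (a b : R) (u : R -> R) :
  continuous u -> mu.-integrable `[a, b] (EFin \o u).
Proof. by move=> cu; apply: segment_integrable; exact: continuous_subspaceT. Qed.

Lemma lipschitz_continuous (K : R) (u : R -> R) :
  (forall x y, `|u x - u y| <= K * `|x - y|) -> continuous u.
Proof.
move=> Hu x; apply/cvgrPdist_le => e e0.
have K1 : 0 < `|K| + 1 by rewrite ltr_wpDl.
near=> y; rewrite (le_trans (Hu _ _)) // (@le_trans _ _ ((`|K| + 1) * `|x - y|)) //.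
  by rewrite ler_wpM2r // (le_trans (ler_norm K)) // lerDl.
rewrite mulrC -ler_pdivlMr //; near: y.
have := @cvgr_dist_le _ _ _ (nbhs x) _ id x (fun _ H => H) (e / (`|K| + 1)).
by apply; rewrite divr_gt0.
Unshelve. all: by end_near. Qed.

Lemma Rintegral_unit_cst (c : R) : Rintegral mu `[0, 1]%classic (fun=> c) = c.
Proof.
by rewrite Rintegral_cst //= lebesgue_measure_itv /= lte_fin ltr01 sube0 mulr1.
Qed.

Lemma Rintegral_unit_dist (u v : R -> R) (e : R) : continuous u -> continuous v ->
  (forall x, `|u x - v x| <= e) ->
  `|Rintegral mu `[0, 1]%classic u - Rintegral mu `[0, 1]%classic v| <= e.
Proof.
move=> cu cv uv.
have iu := @continuous_integrable 0 1 _ cu.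
have iv := @continuous_integrable 0 1 _ cv.
rewrite -RintegralB //.
have cuv : continuous (fun x => u x - v x) by move=> x; apply: cvgB; [exact: cu|exact: cv].
have iuv := @continuous_integrable 0 1 _ cuv.
rewrite (le_trans (le_normr_Rintegral _ _)) // -[leRHS]Rintegral_unit_cst.
apply: le_Rintegral => //; apply: continuous_integrable.
  by move=> x; apply: cvg_norm; exact: cuv.
by move=> x; exact: cvg_cst.
Qed.

(** A class stable under slicing and inner integration with the same constant, so each stage of the
    iterated integral has a continuous, hence integrable, integrand. *)
Definition islip d (f : 'rV[R]_d -> R) := exists K, lip K f.

Lemma islip_cst d (c : R) : islip (fun _ : 'rV[R]_d => c).
Proof. by exists 0 => x y; rewrite subrr normr0 mul0r. Qed.

Lemma islip_lin d (a : R) (f g : 'rV[R]_d -> R) :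
  islip f -> islip g -> islip (fun x => a * f x + g x).
Proof.
move=> [K HK] [L HL]; exists (`|a| * K + L) => x y.
rewrite opprD addrACA -mulrBr (le_trans (ler_normD _ _)) // mulrDl lerD //.
by rewrite normrM -mulrA ler_wpM2l.
Qed.

Definition slice d (f : 'rV[R]_d.+1 -> R) (x : R) : 'rV[R]_d -> R :=
  fun y => f (row_mx (const_mx x : 'rV[R]_1) y).

Lemma torus_intS d (f : 'rV[R]_d.+1 -> R) :
  torus_int f = Rintegral mu `[0, 1]%classic (fun x => torus_int (slice f x)).
Proof. by []. Qed.

Lemma slice_lip d (K : R) (f : 'rV[R]_d.+1 -> R) x x' y y' : lip K f ->
  `|slice f x y - slice f x' y'| <= K * (`|x - x'| + \sum_i `|y 0 i - y' 0 i|).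
Proof.
move=> /(_ (row_mx (const_mx x : 'rV[R]_1) y) (row_mx (const_mx x' : 'rV[R]_1) y')).
rewrite (@big_split_ord _ _ _ 1 d) /= big_ord1.
rewrite !(@row_mxEl _ 1 1 d) !mxE.
by under eq_bigr do rewrite !(@row_mxEr _ 1 1 d).
Qed.

Lemma islip_slice d (f : 'rV[R]_d.+1 -> R) x : islip f -> islip (slice f x).
Proof.
move=> [K HK]; exists K => y y'.
by have := slice_lip x x y y' HK; rewrite subrr normr0 add0r.
Qed.

Lemma torus_int_dist d (f g : 'rV[R]_d -> R) (e : R) : islip f -> islip g ->
  (forall x, `|f x - g x| <= e) -> `|torus_int f - torus_int g| <= e.
Proof.
elim: d f g e => [|d IH] f g e lf lg fg; first exact: fg.
(* The induction hypothesis, applied to two slices of one function, already gives continuity of the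
   inner integral. *)
have cs (h : 'rV[R]_d.+1 -> R) : islip h -> continuous (fun x => torus_int (slice h x)).
  move=> lh; have [K HK] := lh; apply: (@lipschitz_continuous K) => x x'.
  apply: IH => [||y]; [exact: islip_slice|exact: islip_slice|].
  have := slice_lip x x' y y HK.
  by under eq_bigr do rewrite subrr normr0; rewrite big1_eq addr0.
rewrite !torus_intS; apply: Rintegral_unit_dist; [exact: cs|exact: cs|move=> x].
by apply: IH => [||y]; [exact: islip_slice|exact: islip_slice|exact: fg].
Qed.

Lemma torus_int_slice_continuous d (f : 'rV[R]_d.+1 -> R) :
  islip f -> continuous (fun x => torus_int (slice f x)).
Proof.
move=> lf; have [K HK] := lf; apply: (@lipschitz_continuous K) => x x'.
apply: torus_int_dist => [||y]; [exact: islip_slice|exact: islip_slice|].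
have := slice_lip x x' y y HK.
by under eq_bigr do rewrite subrr normr0; rewrite big1_eq addr0.
Qed.

Lemma torus_int_lin d (a : R) (f g : 'rV[R]_d -> R) : islip f -> islip g ->
  torus_int (fun x => a * f x + g x) = a * torus_int f + torus_int g.
Proof.
elim: d f g => [|d IH] f g lf lg //.
have cf := torus_int_slice_continuous lf; have cg := torus_int_slice_continuous lg.
have If := @continuous_integrable 0 1 _ cf.
have Ig := @continuous_integrable 0 1 _ cg.
rewrite !torus_intS -RintegralZl // -RintegralD //; last first.
  apply: continuous_integrable => x.
  by apply: cvgM; [exact: cvg_cst|exact: cf].
apply: eq_Rintegral => x _; rewrite -IH //; exact: islip_slice.
Qed.

Lemma torus_int_cst d (c : R) : torus_int (fun _ : 'rV[R]_d => c) = c.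
Proof.
elim: d => [|d IH] //; rewrite torus_intS -[RHS]Rintegral_unit_cst.
by apply: eq_Rintegral => x _; exact: IH.
Qed.

Lemma torus_int_sum d (I : Type) (s : seq I) (P : pred I) (f : I -> 'rV[R]_d -> R) :
  (forall i, islip (f i)) ->
  islip (fun x => \sum_(i <- s | P i) f i x) /\
  torus_int (fun x => \sum_(i <- s | P i) f i x) = \sum_(i <- s | P i) torus_int (f i).
Proof.
move=> lf; elim: s => [|i s [ls IH]].
  rewrite big_nil (_ : (fun x => _) = fun=> 0); last by apply/funext => x; rewrite big_nil.
  by split; [exact: islip_cst|exact: torus_int_cst].
rewrite big_cons; case Pi : (P i).
  rewrite (_ : (fun x => _) = fun x => 1 * f i x + \sum_(j <- s | P j) f j x); last first.
    by apply/funext => x; rewrite big_cons Pi mul1r.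
  by split; [exact: islip_lin|rewrite torus_int_lin // IH mul1r].
rewrite (_ : (fun x => _) = fun x => \sum_(j <- s | P j) f j x) //.
by apply/funext => x; rewrite big_cons Pi.
Qed.

Lemma islip_cos d (k : 'rV[int]_d) (a : R) : islip (fun x => cos (2 * pi * zdot k x + a)).
Proof.
exists (2 * pi * znorm R k) => x y.
rewrite (le_trans (cos_dist _ _)) // opprD addrACA subrr addr0 -mulrBr -zdotB.
rewrite normrM ger0_norm ?mulr_ge0 ?pi_ge0 // -mulrA ler_wpM2l ?mulr_ge0 ?pi_ge0 //.
rewrite (le_trans (ler_norm_sum _ _ _)) // mulr_sumr ler_sum // => i _.
by rewrite normrM !mxE ler_wpM2r // le_znorm.
Qed.

Lemma torus_int_cos d (k : 'rV[int]_d) (a : R) : k != 0 ->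
  torus_int (fun x => cos (2 * pi * zdot k x + a)) = 0.
Proof.
elim: d k a => [|d IH] k a; first by move/rV0Pn => [[]].
pose k0 := k 0 0; pose k' : 'rV[int]_d := \row_i k 0 (lift ord0 i).
have zE x y : zdot k (row_mx (const_mx x : 'rV[R]_1) y) = k0%:~R * x + zdot k' y.
  have rl : row_mx (const_mx x : 'rV[R]_1) y 0 (lshift d ord0) = x.
    by rewrite (@row_mxEl _ 1 1 d) mxE.
  have rr i : row_mx (const_mx x : 'rV[R]_1) y 0 (rshift 1 i) = y 0 i.
    exact: (@row_mxEr _ 1 1 d).
  rewrite /zdot big_ord_recl; congr (_ + _).
    have e : ord0 = lshift d (ord0 : 'I_1) :> 'I_d.+1 by exact/val_inj.
    by congr (_ * _); rewrite -[RHS]rl e.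
  apply: eq_bigr => i _; rewrite [in RHS]mxE; congr (_ * _).
  have -> : lift ord0 i = rshift 1 i :> 'I_d.+1 by exact/val_inj.
  exact: rr.
move=> kn; rewrite torus_intS.
(* If the remaining frequencies are not all zero, each inner integral vanishes by induction.
   Otherwise only the first variable occurs, and the outer integral runs over whole periods. *)
have [k'0|k'n] := eqVneq k' 0; last first.
  rewrite -[RHS]Rintegral_unit_cst; apply: eq_Rintegral => x _.
  rewrite -[RHS](IH k' (2 * pi * (k0%:~R * x) + a) k'n); congr torus_int.
  by apply/funext => y; rewrite /slice zE; congr cos; ring.
have k00 : k0 != 0.
  apply: contra_neq kn => k00; apply/rowP => i; rewrite mxE.
  have [j ->|->] := unliftP ord0 i.
    by move/rowP: k'0 => /(_ j); rewrite !mxE.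
  by rewrite -k00; congr (k _ _); exact/val_inj.
pose w : R := 2 * pi * k0%:~R.
have w0 : w != 0 by rewrite !mulf_neq0 ?intr_eq0 // ?gt_eqF ?pi_gt0.
transitivity (Rintegral mu `[0, 1]%classic (fun x => cos (w * x + a))).
  apply: eq_Rintegral => x _; rewrite -[RHS](torus_int_cst d); congr torus_int; apply/funext => y.
  by rewrite /slice zE k'0 zdot0 addr0 mulrA.
pose F x := w^-1 * sin (w * x + a).
have dF (x : R) : is_derive x 1 F (cos (w * x + a)).
  have ds := is_derive_affine (is_derive_sin (w * x + a)).
  have := is_deriveZ w^-1 ds.
  by rewrite [_ *: _]mulKf.
rewrite /Rintegral (@continuous_FTC2 _ _ F) ?ltr01 //=.
- rewrite /F mulr0 add0r mulr1.
  have -> : sin (w + a) = sin a by rewrite -!cosBpihalf -addrA addrC cosDint.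
  by rewrite subrr.
- apply: continuous_subspaceT => x; apply: continuous_comp; last exact: continuous_cos.
  by apply: cvgD; [apply: cvgM; [exact: cvg_cst|exact: cvg_id]|exact: cvg_cst].
- exact: derivable_oo_LRcontinuousW dF.
- by move=> x _; rewrite derive1E derive_val.
Qed.

Lemma fcoef_cos d n (F : 'rV[R]_d -> R) (k : 'rV[int]_d) (a : R) :
  fcoef n F k a = fcoef n F k 0 * cos (a + 0) + fcoef n F k (pi / 2) * cos (a - pi / 2).
Proof.
by rewrite fcoef_phase addr0 cosBpihalf mulrC; congr (_ + _); rewrite mulrC.
Qed.

(** All nonzero modes integrate to 0, which leaves the coefficient b_0. *)
Lemma torus_int_interp d n (F : 'rV[R]_d -> R) :
  islip (interp n F) /\ torus_int (interp n F) = avg n.*2 F.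
Proof.
pose f (j : 'rV['I_(n.*2.+1)]_d) : 'rV[R]_d -> R :=
  fun x => fcoef n.*2 F (kvec j) (2 * pi * zdot (kvec j) x).
have fE j : f j = fun x => fcoef n.*2 F (kvec j) 0 * cos (2 * pi * zdot (kvec j) x + 0)
    + (fcoef n.*2 F (kvec j) (pi / 2) * cos (2 * pi * zdot (kvec j) x - pi / 2) + 0).
  by apply/funext => x; rewrite /f fcoef_cos !addr0.
have lf j : islip (f j).
  rewrite fE; do 2 (apply: islip_lin; first exact: islip_cos); exact: islip_cst.
have [ls Es] := torus_int_sum (index_enum _) (fun j => kvec j != 0) lf.
have -> : interp n F = fun x => 1 * avg n.*2 F + \sum_(j | kvec j != 0) f j x.
  by apply/funext => x; rewrite interpE /= mul1r; congr (_ + _).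
split; first by apply: islip_lin => //; exact: islip_cst.
rewrite torus_int_lin ?Es //; last exact: islip_cst.
rewrite torus_int_cst mul1r big1 ?addr0 // => j k0; rewrite fE.
have l0 := islip_cst d (0 : R).
rewrite torus_int_lin; [|exact: islip_cos|by apply: islip_lin => //; exact: islip_cos].
rewrite torus_int_lin; [|exact: islip_cos|by []].
by rewrite !torus_int_cos // torus_int_cst !mulr0 !addr0.
Qed.

End TorusIntegral.

(** * Oscillatory integrals *)

Section Oscillatory.
Set Implicit Arguments.
Unset Strict Implicit.
Variable R : realType.
Local Notation mu := (@lebesgue_measure R).
Local Notation I01 := `[(0 : R), 1]%classic.
Implicit Types (g u v : R -> R).

Lemma continuous_cos_affine (w b : R) : continuous (fun s => cos (w * s + b)).
Proof.
move=> x; apply: continuous_comp; last exact: continuous_cos.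
by apply: cvgD; [apply: cvgM; [exact: cvg_cst|exact: cvg_id]|exact: cvg_cst].
Qed.

Lemma lip_line d (K : R) (F : 'rV[R]_d -> R) (x v : 'rV[R]_d) :
  lip K F -> continuous (fun s : R => F (x + s *: v)).
Proof.
move=> HK; apply: (@lipschitz_continuous _ (K * \sum_i `|v 0 i|)) => s t.
rewrite (le_trans (HK _ _)) // -mulrA [X in _ <= _ * X]mulrC [X in _ <= _ * X]mulr_sumr.
have -> : \sum_i `|(x + s *: v) 0 i - (x + t *: v) 0 i| = \sum_i `|s - t| * `|v 0 i| => //.
apply: eq_bigr => i _; rewrite !mxE opprD addrACA subrr add0r -mulrBl normrM //.
Qed.

Lemma integrableM_within g u : {within I01, continuous g} -> continuous u ->
  mu.-integrable I01 (EFin \o (fun s => g s * u s)).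
Proof.
move=> cg cu; apply: segment_integrable => z.
by apply: continuousM; [exact: cg|exact: continuous_subspaceT].
Qed.

Lemma RintegralM_lin g (a : R) u v :
  {within I01, continuous g} -> continuous u -> continuous v ->
  Rintegral mu I01 (fun s => g s * (a * u s + v s)) =
  a * Rintegral mu I01 (fun s => g s * u s) + Rintegral mu I01 (fun s => g s * v s).
Proof.
move=> cg cu cv; have iu := integrableM_within cg cu; have iv := integrableM_within cg cv.
rewrite -RintegralZl // -RintegralD //; last first.
  have cau : continuous (fun s => a * u s) by move=> x; apply: cvgM; [exact: cvg_cst|exact: cu].
  rewrite (_ : (fun s => a * _) = fun s => g s * (a * u s)); first exact: integrableM_within.
  by apply/funext => s; rewrite mulrCA.
by apply: eq_Rintegral => s _; rewrite mulrDr mulrCA.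
Qed.

Lemma RintegralM_sum g (I : Type) (s : seq I) (P : pred I) (u : I -> R -> R) :
  {within I01, continuous g} -> (forall i, continuous (u i)) ->
  continuous (fun t => \sum_(i <- s | P i) u i t) /\
  Rintegral mu I01 (fun t => g t * \sum_(i <- s | P i) u i t) =
  \sum_(i <- s | P i) Rintegral mu I01 (fun t => g t * u i t).
Proof.
move=> cg cu; elim: s => [|i s [cs IH]].
  rewrite big_nil (_ : (fun t => \sum_(i <- [::] | P i) _) = fun=> 0); last first.
    by apply/funext => t; rewrite big_nil.
  split; first by move=> x; exact: cvg_cst.
  rewrite (_ : (fun t => _) = fun=> 0) ?Rintegral_unit_cst //.
  by apply/funext => t; rewrite big_nil mulr0.
rewrite big_cons; case Pi : (P i).
  have E : (fun t => \sum_(j <- i :: s | P j) u j t) =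
      fun t => 1 * u i t + \sum_(j <- s | P j) u j t.
    by apply/funext => t; rewrite big_cons Pi mul1r.
  split.
    rewrite E => x; apply: cvgD; last exact: cs.
    by apply: cvgM; [exact: cvg_cst|exact: cu].
  rewrite -IH -[X in X + _]mul1r -RintegralM_lin //; congr Rintegral.
  by apply/funext => t; rewrite big_cons Pi mul1r.
have E : (fun t => \sum_(j <- i :: s | P j) u j t) = fun t => \sum_(j <- s | P j) u j t.
  by apply/funext => t; rewrite big_cons Pi.
split; first by rewrite E.
by rewrite -IH; congr Rintegral; apply/funext => t; rewrite big_cons Pi.
Qed.

Lemma RintegralM_le g u (e : R) : {within I01, continuous g} -> continuous u ->
  (forall s, `|u s| <= e) ->
  `|Rintegral mu I01 (fun s => g s * u s)| <= e * Rintegral mu I01 (fun s => `|g s|).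
Proof.
move=> cg cu ue; have igu := integrableM_within cg cu.
have cng : {within I01, continuous (fun s => `|g s|)}.
  by move=> z; apply: cvg_norm; exact: cg.
rewrite (le_trans (le_normr_Rintegral _ _)) // -RintegralZl //; last exact: segment_integrable.
apply: le_Rintegral => // [|| s _].
- apply: segment_integrable => z; apply: cvg_norm.
  by apply: continuousM; [exact: cg|exact: continuous_subspaceT].
- apply: segment_integrable => z; by apply: cvgM; [exact: cvg_cst|exact: cng].
by rewrite normrM mulrC ler_wpM2r.
Qed.

Lemma Rintegral_dilate u (T : R) : 0 < T -> {within I01, continuous u} ->
  T^-1 * Rintegral mu `[0, T]%classic (fun t => u (t / T)) = Rintegral mu I01 u.
Proof.
move=> T0 cu; have Ti : 0 < T^-1 by rewrite invr_gt0.
apply: (mulfI (lt0r_neq0 T0)); rewrite mulrA mulfV ?gt_eqF // mul1r.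
rewrite -RintegralZl //; last exact: segment_integrable.
pose F t := T^-1 * t + 0.
have dF (t : R) : is_derive t 1 F T^-1.
  have := @is_derive_affine _ id T^-1 0 t 1 (is_derive_id _ _).
  by rewrite mulr1.
have F'E : F^`()%classic = cst T^-1 by apply/funext => t; rewrite derive1E derive_val.
have FE t : F t = t / T by rewrite /F addr0 mulrC.
have uE t : T * u (F t) * T^-1 = u (t / T).
  by rewrite FE mulrAC mulfV ?gt_eqF // mul1r.
have F0 : F 0 = 0 by rewrite /F mulr0 addr0.
have FT : F T = 1 by rewrite /F addr0 mulVf ?gt_eqF.
(* Substituting in [T * u] rather than [u] makes the Jacobian [T^-1] cancel. *)
have := @integration_by_substitution_increasing _ F (fun s => T * u s) 0 T (ltW T0).
rewrite F'E F0 FT => H.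
rewrite /Rintegral H; last 6 first.
- by move=> x y _ _ xy; rewrite /F !addr0 ltr_pM2l.
- by move=> x _; exact: cvg_cst.
- by apply: is_cvg_cst.
- by apply: is_cvg_cst.
- exact: derivable_oo_LRcontinuousW dF.
- by move=> z; apply: cvgM; [exact: cvg_cst|exact: cu].
congr fine; apply: eq_integral => t _; congr EFin.
by rewrite -[LHS]uE.
Qed.

Lemma derivs_on01_is_derive m g gs i (x : R) : derivs_on01 m g gs -> (i < m)%N ->
  0 < x < 1 -> is_derive x 1 (gs i) (gs i.+1 x).
Proof.
move=> [_ [D _]] im /andP[x0 x1].
have {D} := D i im x; rewrite (ltW x0) (ltW x1) => /(_ isT) D.
have H : h^-1 *: ((gs i \o shift x) (h *: (1 : R)) - gs i x) @[h --> 0^'] --> gs i.+1 x.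
  apply/cvgrPdist_le => e e0.
  move/cvgrPdist_le: D => /(_ e e0); rewrite near_withinE => /nbhs_ballP[r /= r0 Hr].
  near=> h; have h0 : h != 0 by near: h; exact: nbhs_dnbhs_neq.
  (* For such [h] the point [h + x] stays in [0, 1], where the quotient restricted to the segment is
     the ordinary one. *)
  have hr : `|h| < Num.min r (Num.min x (1 - x)).
    by near: h; apply: dnbhs0_lt; rewrite !lt_min r0 x0 subr_gt0.
  move: hr; rewrite !lt_min !ltr_norml => /and3P[/andP[r1 r2] /andP[x2 _] /andP[_ x3]].
  have := Hr (h + x); rewrite /ball /= opprD addrCA subrr addr0 normrN ltr_norml r1 r2.
  move=> /(_ isT) Hd; rewrite [h *: 1]mulr1 [_ *: _]mulrC.
  have := Hd; rewrite addrK; apply; split; first by apply/andP; split; lra.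
  by rewrite -subr_eq0 addrK.
apply: DeriveDef; first by apply/cvg_ex; exists (gs i.+1 x).
exact: cvg_lim.
Unshelve. all: by end_near. Qed.

Lemma derivs_on01_LR m g gs i : derivs_on01 m g gs -> (i < m)%N ->
  derivable_oo_LRcontinuous (gs i) 0 1.
Proof.
move=> Dg im; have [_ [_ C]] := Dg.
have [c0 cl cr] := (continuous_within_itvP _ ltr01).1 (C i (ltnW im)).
split => // x /[!in_itv] /= x01.
exact: (@ex_derive _ _ _ _ _ _ _ (derivs_on01_is_derive Dg im x01)).
Qed.

Lemma Gm_continuous m g : Gm m g -> {within I01, continuous g}.
Proof.
move=> [gs [[gE [_ gC]] _]].
apply: (@subspace_eq_continuous _ _ _ (gs 0)); last exact: gC.
by move=> s; rewrite inE /= in_itv /= => /gE.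
Qed.

(** Each of [m] integrations by parts gains a factor 1/|w|; the boundary terms vanish with the
    derivatives of order below [m]. What remains is bounded by the integral of |g^(m)|. *)
Lemma oscillatory_decay m g : Gm m g ->
  exists2 A : R, 0 <= A & forall w b : R, w != 0 ->
    `|Rintegral mu I01 (fun s => g s * cos (w * s + b))| <= A * `|w| ^- m.
Proof.
move=> [gs [Dg [_ [_ B]]]]; have [E [_ C]] := Dg.
exists (Rintegral mu I01 (fun s => `|gs m s|)); first exact: Rintegral_ge0.
move=> w b w0.
have -> : Rintegral mu I01 (fun s => g s * cos (w * s + b)) =
    Rintegral mu I01 (fun s => gs 0 s * cos (w * s + b)).
  by apply: eq_Rintegral => s; rewrite inE /= in_itv /= => /E ->.
(* Induction on the number [r] of integrations still to do. The phase is generalized because each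
   one shifts it by -pi/2. *)
suff H r i b' : (i + r = m)%N ->
    `|Rintegral mu I01 (fun s => gs i s * cos (w * s + b'))| <=
    Rintegral mu I01 (fun s => `|gs m s|) * `|w| ^- r by exact: H.
elim: r i b' => [|r IH] i b'.
  rewrite addn0 => ->; rewrite expr0 invr1 mulr1 -[leRHS]mul1r.
  by apply: RintegralM_le => [||s]; [exact: C|exact: continuous_cos_affine|exact: cos_max].
rewrite addnS -addSn => im.
have im' : (i < m)%N by rewrite -im leq_addr.
pose G (s : R) := w^-1 * sin (w * s + b').
have dG (s : R) : is_derive s 1 G (cos (w * s + b')).
  have := is_deriveZ w^-1 (is_derive_affine (is_derive_sin (w * s + b'))).
  by rewrite [_ *: _]mulKf.
rewrite (@Rintegration_by_parts _ (gs i) G (gs i.+1) (fun s => cos (w * s + b'))) //; last 6 first.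
- exact: C.
- exact: derivs_on01_LR Dg im'.
- move=> s /[!in_itv] /= s01.
  by rewrite derive1E (@derive_val _ _ _ _ _ _ _ (derivs_on01_is_derive Dg im' s01)).
- by apply: continuous_subspaceT; exact: continuous_cos_affine.
- exact: derivable_oo_LRcontinuousW dG.
- by move=> s _; rewrite derive1E derive_val.
have [-> ->] := B _ im'; rewrite !mul0r subrr sub0r normrN.
have cosE s : gs i.+1 s * G s = gs i.+1 s * (w^-1 * cos (w * s + (b' - pi / 2)) + 0).
  by rewrite addr0 addrA cosBpihalf.
rewrite (_ : (fun s => _ * G s) = fun s => gs i.+1 s *
    (w^-1 * cos (w * s + (b' - pi / 2)) + 0)); last exact/funext.
have c0 : continuous ((fun=> 0) : R -> R) by move=> x; exact: cvg_cst.
rewrite RintegralM_lin //; [|exact: C|exact: continuous_cos_affine].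
rewrite (_ : (fun s => gs i.+1 s * 0) = fun=> 0); last by apply/funext => s; rewrite mulr0.
rewrite Rintegral_unit_cst addr0 normrM normfV mulrC exprSr invfM mulrA.
by rewrite ler_wpM2r ?invr_ge0 // IH.
Qed.

End Oscillatory.

(** * Weighted averages along the flow *)

Section WeightedAverage.
Set Implicit Arguments.
Unset Strict Implicit.
Variable R : realType.
Local Notation mu := (@lebesgue_measure R).
Local Notation I01 := `[(0 : R), 1]%classic.

Lemma small_divisor d (c tau T : R) (m : nat) (omega : 'rV[R]_d) (k : 'rV[int]_d) :
  0 < c -> 0 < T -> diophantine c tau omega -> k != 0 ->
  2 * pi * zdot k (T *: omega) != 0 /\
  `|2 * pi * zdot k (T *: omega)| ^- m <= (c * T) ^- m * znorm R k `^ (m%:R * tau).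
Proof.
move=> c0 T0 dio k0; have z0 := lt_le_trans ltr01 (znorm_ge1 R k0).
have p0 : 0 < 2 * pi :> R by rewrite mulr_gt0 ?pi_gt0.
have cz : 0 < c * T * znorm R k `^ (- tau) by rewrite !mulr_gt0 ?powR_gt0.
have lb : c * T * znorm R k `^ (- tau) <= `|2 * pi * zdot k (T *: omega)|.
  rewrite zdotZ normrM (gtr0_norm p0) normrM (gtr0_norm T0).
  apply: (@le_trans _ _ (T * `|zdot k omega|)).
    by rewrite (mulrC c) -mulrA ler_wpM2l ?(ltW T0) // ltW // dio.
  rewrite ler_peMl ?mulr_ge0 ?(ltW T0) //.
  by have := pi_ge2 R; lra.
have wp := lt_le_trans cz lb.
split; first by rewrite -normr_gt0.
apply: (@le_trans _ _ ((c * T * znorm R k `^ (- tau)) ^- m)).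
  rewrite lef_pV2 ?posrE ?exprn_gt0 //.
  by rewrite lerXn2r ?nnegrE ?(ltW cz).
rewrite exprMn invfM powRN exprVn invrK -(powR_mulrn m (powR_ge0 _ tau)).
by rewrite -powRrM (mulrC tau).
Qed.

(** The trailing 0 puts the expression in the nested form [a * u + v] on which [RintegralM_lin] acts
    twice. *)
Lemma fcoef_line d n (F : 'rV[R]_d -> R) (k : 'rV[int]_d) (x v : 'rV[R]_d) (s : R) :
  fcoef n F k (2 * pi * zdot k (x + s *: v)) =
  fcoef n F k 0 * cos (2 * pi * zdot k v * s + 2 * pi * zdot k x) +
  (fcoef n F k (pi / 2) *
    cos (2 * pi * zdot k v * s + (2 * pi * zdot k x - pi / 2)) + 0).
Proof.
rewrite addr0 fcoef_cos addr0 zdotD zdotZ.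
by congr (_ * cos _ + _ * cos _); ring.
Qed.

Lemma continuous_lin (a : R) (u v : R -> R) :
  continuous u -> continuous v -> continuous (fun s => a * u s + v s).
Proof.
move=> cu cv y; apply: cvgD; last exact: cv.
by apply: cvgM; [exact: cvg_cst|exact: cu].
Qed.

Lemma continuous_zero : continuous ((fun=> 0) : R -> R).
Proof. by move=> y; exact: cvg_cst. Qed.

Lemma continuous_fcoef_line d n (F : 'rV[R]_d -> R) (k : 'rV[int]_d) (x v : 'rV[R]_d) :
  continuous (fun s : R => fcoef n F k (2 * pi * zdot k (x + s *: v))).
Proof.
rewrite (funext (fcoef_line n F k x v)).
do 2 (apply: continuous_lin; first exact: continuous_cos_affine).
exact: continuous_zero.
Qed.

Lemma RintegralM_fcoef d n (F : 'rV[R]_d -> R) (k : 'rV[int]_d) (x v : 'rV[R]_d)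
    (g : R -> R) (A B : R) (m : nat) :
  {within I01, continuous g} -> (forall a, `|fcoef n F k a| <= B) ->
  (forall w b : R, w != 0 ->
    `|Rintegral mu I01 (fun s => g s * cos (w * s + b))| <= A * `|w| ^- m) ->
  2 * pi * zdot k v != 0 ->
  `|Rintegral mu I01 (fun s => g s * fcoef n F k (2 * pi * zdot k (x + s *: v)))| <=
    2 * B * (A * `|2 * pi * zdot k v| ^- m).
Proof.
move=> cg HB HA w0.
have c2 := @continuous_cos_affine R (2 * pi * zdot k v) (2 * pi * zdot k x - pi / 2).
rewrite (funext (fun s => congr1 ( *%R (g s)) (fcoef_line n F k x v s))).
rewrite RintegralM_lin //; [|exact: continuous_cos_affine|]; last first.
  by apply: continuous_lin => //; exact: continuous_zero.
rewrite (RintegralM_lin _ cg c2 continuous_zero).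
rewrite (_ : (fun s => g s * 0) = fun=> 0); last by apply/funext => s; rewrite mulr0.
rewrite Rintegral_unit_cst addr0 (le_trans (ler_normD _ _)) //.
set W := A * _; rewrite [leRHS](_ : _ = B * W + B * W); last by ring.
apply: lerD; rewrite (normrM (fcoef _ _ _ _)).
  by apply: ler_pM => //; exact: HA.
by apply: ler_pM => //; exact: HA.
Qed.

Lemma weighted_average_decay d m l (H : 'rV[R]_d -> R) (g : R -> R)
    (omega : 'rV[R]_d) (c tau : R) :
  0 < c -> d%:R - 1 <= tau -> diophantine c tau omega ->
  Gm m g -> Defs.periodic H -> Ck l H -> d%:R + m%:R * tau < l%:R ->
  exists2 C : R, 0 <= C & forall (T : R) (x : 'rV[R]_d), 0 < T ->
    `|Rintegral mu I01 (fun s => g s * H (x + s *: (T *: omega))) - torus_int H|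
      <= C * T ^- m.
Proof.
move=> c0 dtau dio Gg pH CH dl.
have [_ [_ [g0 [g1 _]]]] := Gg.
have cg := Gm_continuous Gg.
have gn : Rintegral mu I01 (fun s => `|g s|) = 1.
  rewrite -[RHS]g1; apply: eq_Rintegral => s; rewrite inE /= in_itv /= => /g0.
  exact: ger0_norm.
(* In dimension 0 the space is a single point, so [H] is constant and the error is exactly 0. *)
case: (posnP d) => [d0|dgt0].
  exists 0 => // T x T0; rewrite mul0r.
  have HE y : H y = H 0.
    by congr H; apply/rowP => i; have := ltn_ord i; rewrite [X in (_ < X)%N]d0.
  rewrite (_ : H = fun=> H 0); last exact/funext.
  rewrite torus_int_cst RintegralZr //; last exact: segment_integrable.
  by rewrite g1 mul1r subrr normr0.
have tau0 : 0 <= tau by rewrite (le_trans _ dtau) // subr_ge0 ler1n.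
have dltl : (d < l)%N.
  by rewrite -(ltr_nat R) (le_lt_trans _ dl) // lerDl mulr_ge0.
have C1 : Ck 1 H by apply: Ck_weaken CH; exact: leq_ltn_trans dltl.
have [K K0 HK] := Ck1_lip pH C1.
have [A A0 HA] := oscillatory_decay Gg.
have [B B0 HB] := fcoef_decay pH CH.
(* Decay |k|^(-l) of the coefficients against the small-divisor loss |k|^(m tau). *)
have dl' : d%:R < l%:R - m%:R * tau by rewrite ltrBrDr.
have [S S0 HS] := lattice_sum_bounded dgt0 dl'.
pose C := 2 * B * A * c ^- m * S.
exists C => [|T x T0].
  by rewrite !mulr_ge0 // invr_ge0 exprn_ge0 // ltW.
set v := T *: omega.
(* The bound [C * T ^- m] is uniform in [n], so [n] may depend on [e]; the two replacements of [H]
   by its interpolant cost e/2 each. *)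
apply/ler_addgt0Pr => e e0.
have e2 : 0 < e / 2 by rewrite divr_gt0.
have [n Hn] := interp_cvg dltl pH CH e2.
have [[L HL] It] := torus_int_interp n H.
have cH := lip_line (x := x) (v := v) HK.
have cI := lip_line (x := x) (v := v) HL.
have J1 : `|Rintegral mu I01 (fun s => g s * H (x + s *: v)) -
    Rintegral mu I01 (fun s => g s * interp n H (x + s *: v))| <= e / 2.
  have cD : continuous (fun s : R => -1 * interp n H (x + s *: v) + H (x + s *: v)).
    exact: continuous_lin.
  rewrite addrC -mulN1r -RintegralM_lin // -[leRHS]mulr1 -[X in _ <= _ * X]gn.
  by apply: RintegralM_le => // s; rewrite mulN1r addrC distrC.
have J2 : `|torus_int (interp n H) - torus_int H| <= e / 2.
  by apply: torus_int_dist => //; [exists L|exists K].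
have J3 : `|Rintegral mu I01 (fun s => g s * interp n H (x + s *: v)) -
    torus_int (interp n H)| <= C * T ^- m.
  rewrite It.
  rewrite (_ : (fun s => _) = fun s => g s * (avg n.*2 H * 1 +
      \sum_(j : 'rV['I_(n.*2.+1)]_d | kvec j != 0)
        fcoef n.*2 H (kvec j) (2 * pi * zdot (kvec j) (x + s *: v)))); last first.
    by apply/funext => s; rewrite interpE mulr1.
  have c1 : continuous ((fun=> 1) : R -> R) by move=> y; exact: cvg_cst.
  have [cs Es] := RintegralM_sum (index_enum 'rV['I_(n.*2.+1)]_d)
    (fun j => kvec j != 0) cg (fun j => @continuous_fcoef_line d n.*2 H (kvec j) x v).
  rewrite RintegralM_lin // Es (_ : (fun s => g s * 1) = g); last first.
    by apply/funext => s; rewrite mulr1.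
  (* As [g] has integral 1, the zero mode cancels the torus integral of the interpolant exactly. *)
  rewrite g1 mulr1 addrC addKr (le_trans (ler_norm_sum _ _ _)) //.
  rewrite /C mulrAC; apply: le_trans (ler_wpM2l _ (HS n)); last first.
    by rewrite !mulr_ge0 // invr_ge0 exprn_ge0 // ltW.
  rewrite mulr_sumr; apply: ler_sum => j k0.
  have [w0 wm] := small_divisor m c0 T0 dio k0.
  rewrite (le_trans (RintegralM_fcoef x cg (fun a => HB n j a k0) HA w0)) //.
  rewrite opprB addrC powRD; last first.
    by rewrite (gt_eqF (lt_le_trans ltr01 (znorm_ge1 R k0))) implybT.
  set z := znorm R _ in wm *; move: wm; rewrite exprMn invfM => wm.
  apply: (@le_trans _ _ (2 * (B * z `^ (- l%:R)) *
    (A * (c ^- m * T ^- m * z `^ (m%:R * tau))))).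
    by rewrite !ler_wpM2l // !mulr_ge0 ?powR_ge0.
  rewrite le_eqVlt; apply/orP; left; apply/eqP; ring.
rewrite [X in _ <= _ + X]splitr [leRHS]addrCA.
rewrite -(subrKA (Rintegral mu I01 (fun s => g s * interp n H (x + s *: v)))).
rewrite (le_trans (ler_normD _ _)) // lerD //.
by rewrite -(subrKA (torus_int (interp n H))) (le_trans (ler_normD _ _)) // lerD.
Qed.

End WeightedAverage.

(** * Transfer from the torus to [M] *)

Lemma exists_nat_gt (R : realType) (x : R) : exists n : nat, x < n%:R.
Proof.
exists (Num.truncn `|x|).+1; rewrite (le_lt_trans (ler_norm x)) //.
by have /andP[] := truncn_itv (normr_ge0 x).
Qed.

Lemma intM_torus (R : realType) (d : nat) (M : Type) (Phi : M -> 'rV[R]_d)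
    (Psi : 'rV[R]_d -> M) (h : M -> R) (H : 'rV[R]_d -> R) :
  (forall v, in_fund v -> Phi (Psi v) = v) -> Defs.periodic H ->
  (forall x, h x = H (Phi x)) -> intM Psi h = torus_int H.
Proof.
move=> PP pH hH; rewrite /intM; congr torus_int; apply/funext => v.
by rewrite hH PP ?periodic_fracv //; exact: fracv_fund.
Qed.

(** Periodicity of [H] removes [fracv], so the orbit unrolls to a straight line in R^d; the
    substitution t = T s then normalizes the time interval. *)
Lemma WB_line (R : realType) (d : nat) (M : Type) (Phi : M -> 'rV[R]_d)
    (phi : R -> M -> M) (omega : 'rV[R]_d) (h : M -> R) (H : 'rV[R]_d -> R)
    (m : nat) (g : R -> R) (T : R) (x : M) :
  (forall (t : R) (x : M), Phi (phi t x) = fracv (Phi x + t *: omega)) ->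
  Defs.periodic H -> continuous H -> (forall x, h x = H (Phi x)) -> Gm m g -> 0 < T ->
  WB phi g h T x = Rintegral (@lebesgue_measure R) `[(0 : R), 1]%classic
    (fun s => g s * H (Phi x + s *: (T *: omega))).
Proof.
move=> flow pH cH hH Gg T0.
have cg := Gm_continuous Gg.
pose u (s : R) := g s * H (Phi x + s *: (T *: omega)).
rewrite -(@Rintegral_dilate _ u T T0); last first.
  move=> z; apply: continuousM; first exact: cg.
  apply: continuous_subspaceT => s; apply: continuous_comp; last exact: cH.
  by apply: cvgD; [exact: cvg_cst|apply: cvgZr_tmp; exact: cvg_id].
rewrite /WB; congr (_ * Rintegral _ _ _); apply/funext => t.
rewrite /u hH flow periodic_fracv // scalerA divfK ?gt_eqF //.
Qed.

Theorem mainTheorem3 (R : realType) (d : nat) (M : Type)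
  (Phi : M -> 'rV[R]_d) (Psi : 'rV[R]_d -> M) (phi : R -> M -> M)
  (omega : 'rV[R]_d) (c tau : R) :
  (forall x, in_fund (Phi x)) ->
  (forall x, Psi (Phi x) = x) ->
  (forall v, in_fund v -> Phi (Psi v) = v) ->
  (forall (t : R) (x : M), Phi (phi t x) = fracv (Phi x + t *: omega)) ->
  0 < c -> d%:R - 1 <= tau -> diophantine c tau omega ->
  (* (i) *)
  (forall (h : M -> R) (g : R -> R), CinfM Phi h -> Ginf g ->
     forall m : nat, exists cm : R, 0 < cm /\
       forall (T : R) (x : M), 0 < T ->
         `|WB phi g h T x - intM Psi h| <= cm * T ^- m) /\
  (* (ii) *)
  (forall (m : nat) (g : R -> R) (l : nat) (h : M -> R),
     Gm m g -> CkM Phi l h -> d%:R + m%:R * tau < l%:R ->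
     exists c' : R, 0 < c' /\
       forall (T : R) (x : M), 0 < T ->
         `|WB phi g h T x - intM Psi h| <= c' * T ^- m).
Proof.
move=> _ _ PhiPsi flow c0 dtau dio.
have main (m : nat) (g : R -> R) (l : nat) (h : M -> R) :
    Gm m g -> CkM Phi l h -> d%:R + m%:R * tau < l%:R ->
    exists c' : R, 0 < c' /\ forall (T : R) (x : M), 0 < T ->
      `|WB phi g h T x - intM Psi h| <= c' * T ^- m.
  move=> Gg [H [pH [CH hH]]] dl.
  have [C C0 HC] := weighted_average_decay c0 dtau dio Gg pH CH dl.
  (* [C] is only nonnegative, and a strictly positive constant is asked for. *)
  exists (C + 1); split=> [|T x T0]; first by rewrite ltr_wpDl.
  rewrite (intM_torus PhiPsi pH hH) (WB_line _ flow pH (Ck_continuous CH) hH Gg T0).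
  rewrite (le_trans (HC T (Phi x) T0)) // ler_wpM2r ?lerDl //.
  by rewrite invr_ge0 exprn_ge0 // ltW.
split; last exact: main.
move=> h g [H [pH [CH hH]]] [gs [Dg [g0 [g1 gB]]]] m.
(* Part (i) is part (ii) with [l] chosen large for the given [m]. *)
have [l dl] := exists_nat_gt (d%:R + m%:R * tau).
apply: (main m g l h) => //; last by exists H.
by exists gs; split; [exact: Dg|split => //; split => // i _; exact: gB].
Qed.
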